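(* Suppose $A$ is a residually finite-dimensional $C^*$-algebra which has an infinite-dimensional irreducible representation. Then there exists an infinite sequence of positive integers $M_1<M_2<\cdots$ such that for any finite sequence of real numbers $0\le\lambda_1\le\lambda_2\le\dots\le\lambda_N\le\lambda$ there is $a\in A$ such that $\|a\|_{\mathbb{M}_{M_k}}=\lambda_k$ for $1\le k\le N$, $\|a\|=\lambda$, and, in the case $\lambda>\lambda_N$, $\|a\|\ne\|a\|_{\mathbb{M}_{M_k}}$ for every $k<\infty$.
   Context: A $C^*$-algebra is residually finite-dimensional if it has a family of finite-dimensional representations such that for every nonzero $a$ some member $\pi$ of the family satisfies $\pi(a)\ne0$. For $n\in\mathbb{N}$ such that $A$ has an irreducible representation of dimension at most $n$, and $a\in A$, $$\|a\|_{\mathbb{M}_n}=\sup\{\|\pi(a)\|\;:\;\pi:A\to\mathbb{M}_n\text{ a }*\text{-homomorphism}\},$$ where $\mathbb{M}_n$ is the algebra of complex $n\times n$ matrices and the $*$-homomorphisms are not required to be non-degenerate; equivalently, the supremum is over all irreducible representations of $A$ of dimension at most $n$. *)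

(* Defs.v *)
From HB Require Import structures.
From mathcomp Require Import all_boot all_order all_algebra.
From mathcomp Require Import all_classical all_reals all_analysis.
From mathcomp Require Import complex.

Set Implicit Arguments.
Unset Strict Implicit.
Unset Printing Implicit Defensive.

Import Order.TTheory GRing.Theory Num.Theory.
Import numFieldNormedType.Exports.

Local Open Scope classical_set_scope.
Local Open Scope complex_scope.
Local Open Scope ring_scope.

(* MathComp rings have a unit, C*-algebras need not: the product is therefore
   part of the mixin. The norm takes its values in R[i]. *)
HB.mixin Record isCStarAlgebra (R : realType) A
    & CompleteNormedModule R[i] A := {
  cmul : A -> A -> A;
  cadj : A -> A;
  cmulA : associative cmul;
  cmul_linearl : forall b, linear (cmul^~ b);
  cmul_linearr : forall a, linear (cmul a);
  cmul_norm : forall a b, `|cmul a b| <= `|a| * `|b|;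
  cadjK : involutive cadj;
  cadj_antilinear : forall (k : R[i]) a b,
    cadj (k *: a + b) = Num.conj k *: cadj a + cadj b;
  cadjM : forall a b, cadj (cmul a b) = cmul (cadj b) (cadj a);
  cstar_identity : forall a, `|cmul (cadj a) a| = `|a| ^+ 2
}.

#[short(type="cstarAlgType")]
HB.structure Definition CStarAlgebra (R : realType) :=
  {A of CompleteNormedModule R[i] A & isCStarAlgebra R A}.

(* A complete complex normed space whose norm comes from an inner product,
   linear in the first argument and antilinear in the second. *)
HB.mixin Record isHilbert (R : realType) H & CompleteNormedModule R[i] H := {
  inner : {dot H for Num.conj};
  inner_norm : forall x : H, `|x| ^+ 2 = inner x x
}.

#[short(type="hilbertType")]
HB.structure Definition Hilbert (R : realType) :=
  {H of CompleteNormedModule R[i] H & isHilbert R H}.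

Definition dim_at_most (R : realType) (H : hilbertType R) (n : nat) : Prop :=
  exists e : 'I_n -> H,
    forall x : H, exists c : 'I_n -> R[i], x = \sum_(i < n) c i *: e i.

Definition finite_dim (R : realType) (H : hilbertType R) : Prop :=
  exists n, dim_at_most H n.

(* *-homomorphisms from A to B(H); they may be degenerate. *)
Record representation (R : realType) (A : cstarAlgType R) (H : hilbertType R)
    (pi : A -> H -> H) : Prop := Representation {
  rep_linear : forall a, linear (pi a);
  rep_bounded : forall a, continuous (pi a);
  rep_lin : forall (k : R[i]) a b x, pi (k *: a + b) x = k *: pi a x + pi b x;
  rep_mul : forall a b x, pi (cmul a b) x = pi a (pi b x);
  rep_adj : forall a x y, inner (pi (cadj a) x) y = inner x (pi a y)
}.

Record closed_subspace (R : realType) (H : hilbertType R) (V : set H) : Prop :=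
  ClosedSubspace {
    csub0 : V 0;
    csub_lin : forall (k : R[i]) x y, V x -> V y -> V (k *: x + y);
    csub_closed : closed V
  }.

(* The first clause excludes the zero representation on a line. *)
Definition irreducible (R : realType) (A : cstarAlgType R) (H : hilbertType R)
    (pi : A -> H -> H) : Prop :=
  (exists a x, pi a x <> 0) /\
  forall V : set H, closed_subspace V ->
    (forall a x, V x -> V (pi a x)) -> V = [set 0] \/ V = setT.

Definition residually_finite_dim (R : realType) (A : cstarAlgType R) : Prop :=
  exists (I : Type) (H : I -> hilbertType R) (pi : forall i, A -> H i -> H i),
    (forall i, representation (pi i) /\ finite_dim (H i)) /\
    forall a : A, a <> 0 -> exists i x, pi i a x <> 0.

Definition has_infinite_dim_irrep (R : realType) (A : cstarAlgType R) : Prop :=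
  exists (H : hilbertType R) (pi : A -> H -> H),
    [/\ representation pi, irreducible pi & ~ finite_dim H].

Definition has_irrep_dim_at_most (R : realType) (A : cstarAlgType R) (n : nat)
    : Prop :=
  exists (H : hilbertType R) (pi : A -> H -> H),
    [/\ representation pi, irreducible pi & dim_at_most H n].

Definition l2norm (R : realType) (n : nat) (v : 'cV[R[i]]_n) : R :=
  Num.sqrt (\sum_(i < n) (complex.Re (v i 0) ^+ 2 + complex.Im (v i 0) ^+ 2)).

(* The C*-norm of 'M_n; the norm which MathComp-Analysis puts on matrices is
   the maximum of the norms of the entries. *)
Definition opnorm (R : realType) (n : nat) (M : 'M[R[i]]_n) : R :=
  sup [set l2norm (M *m v) | v in [set v | l2norm v <= 1]].

Record matrix_star_hom (R : realType) (A : cstarAlgType R) (n : nat)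
    (pi : A -> 'M[R[i]]_n) : Prop := MatrixStarHom {
  mhom_linear : linear pi;
  mhom_mul : forall a b, pi (cmul a b) = pi a *m pi b;
  mhom_adj : forall a, pi (cadj a) = map_mx Num.conj (pi a)^T
}.

Definition norm_Mn (R : realType) (A : cstarAlgType R) (n : nat) (a : A) : R :=
  sup [set opnorm (pi a) | pi in [set pi : A -> 'M[R[i]]_n | matrix_star_hom pi]].

(* Main.v *)
From HB Require Import structures.
Require Import Defs.
From mathcomp Require Import all_boot all_order all_algebra.
From mathcomp Require Import all_classical all_reals all_analysis.
From mathcomp Require Import complex.
From mathcomp Require Import ring lra.

Set Implicit Arguments.
Unset Strict Implicit.
Unset Printing Implicit Defensive.

Import Order.TTheory GRing.Theory Num.Theory.
Import numFieldNormedType.Exports.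
Local Open Scope classical_set_scope.
Local Open Scope complex_scope.
Local Open Scope ring_scope.

(** The idea is to find once and for all integers M_0 < M_1 < ... and elements
    b_0, b_1, ... of A with the following properties: each b_k is contractive;
    b_j is killed by every *-homomorphism into the M_k x M_k matrices with
    k < j; and for each k there is a *-homomorphism rho into the M_k x M_k
    matrices and a nonzero vector v with rho(b_j) v = v for all j <= k
    ([tower_exists]). Given a nondecreasing sequence L_0 <= L_1 <= ... with
    supremum lambda, put
      a = L_0 b_0 + (L_1 - L_0) b_1 + (L_2 - L_1) b_2 + ...
    A *-homomorphism into the M_k x M_k matrices only sees the first k + 1
    terms, so its value at a has norm at most L_k; the vector v is an
    eigenvector of rho(a) for L_k. Hence the M_k-norm of a is exactly L_k, and
    the norm of a is lambda ([realize]). For the theorem take L_k = lambda_k for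
    k <= N and let L approach lambda geometrically after N; the value lambda is
    not reached when lambda > lambda_N.

    Since rho(b_j) has to fix the same v for all j <= k, the b_j are nested: they
    come with elements g_j such that b_j g_j = g_j, and b_{j+1} and g_{j+1} are
    supported inside the support of g_j. Any nonzero vector in the range of
    rho(g_k) then works, and by residual finite-dimensionality it is enough that
    g_k is not 0. This is where the infinite-dimensional irreducible
    representation s enters: s(g_k) is kept nonzero throughout. The
    construction continues because for every n there is a w with s(w) <> 0
    killed by all *-homomorphisms into the n x n matrices ([live_killed]), and
    because s(g) and s(w) nonzero imply that s(g y w) is nonzero for some y
    ([live_prime]).

    To find w, choose n + 1 pairwise orthogonal selfadjoint elements
    g_0, ..., g_n with all s(g_i) nonzero. In the n x n matrices at least one of
    n + 1 orthogonal selfadjoint matrices is 0, so every product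
    g_0 y_0 g_1 y_1 ... g_n is killed. The g_i exist because s has infinite
    dimension ([orthogonal_family_exists]): if a family cannot be enlarged by an
    element orthogonal to all its members, then the identity operator is a finite
    sum of operators s(b_i), so that one of them has rank at least 2, and an
    element supported inside the support of g_i splits into a positive and a
    negative part which both have nonzero image under s ([split_support]).

    All of this needs a little continuous functional calculus, obtained from
    one construction: the square root 1 - P of 1 - K for a selfadjoint
    contraction K, where P is the limit of the iteration P := (K + P^2)/2 started
    at 0 ([sqrt_fixpoint]). It gives absolute values |T| = sqrt(1 - (1 - T^2)),
    hence positive and negative parts, the contractivity of *-actions on Hilbert
    spaces, and pairs b, g with b g = g ([urysohn_exists]). *)

(** * Norms as real numbers, and inner products *)

Section RealNorm.
Variable R : realType.

(** The norm of a normed module over [R[i]] takes values in [R[i]]; its values are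
    real, and the order of [R] is total. *)
Definition nr (V : normedModType R[i]) (x : V) : R := complex.Re `|x|.

Variable V : normedModType R[i].
Implicit Types (x y : V) (k : R[i]).

Lemma nrE x : `|x| = (nr x)%:C.
Proof. by rewrite /nr RRe_real // ger0_real. Qed.

Lemma nr_ge0 x : 0 <= nr x.
Proof. by rewrite -ler0c -nrE. Qed.

Lemma nr0 : nr (0 : V) = 0.
Proof. by rewrite /nr normr0. Qed.

Lemma nr_eq0 x : nr x = 0 -> x = 0.
Proof. by move=> h; apply/normr0_eq0; rewrite nrE h. Qed.

Lemma nr_gt0 x : x <> 0 -> 0 < nr x.
Proof. by move=> h; rewrite lt_neqAle nr_ge0 andbT eq_sym; apply/eqP => /nr_eq0. Qed.

Lemma nrD x y : nr (x + y) <= nr x + nr y.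
Proof. by rewrite -lecR rmorphD /= -!nrE ler_normD. Qed.

Lemma nrN x : nr (- x) = nr x.
Proof. by rewrite /nr normrN. Qed.

Lemma nrBC x y : nr (x - y) = nr (y - x).
Proof. by rewrite -nrN opprB. Qed.

Lemma nrB x y : nr (x - y) <= nr x + nr y.
Proof. by rewrite -(nrN y) nrD. Qed.

End RealNorm.

Section RealNormScale.
Variables (R : realType) (V : normedModType R[i]).

Lemma nrZ (k : R[i]) (x : V) : nr (k *: x) = nr (k : R[i]^o) * nr x.
Proof. by apply: complexI; rewrite rmorphM /= -!nrE normrZ. Qed.

Lemma nr_real (r : R) : nr (r%:C : R[i]^o) = `|r|.
Proof. by apply: complexI; rewrite -nrE; rewrite normc_def /= expr0n addr0 sqrtr_sqr. Qed.

Lemma nrZr (r : R) (x : V) : nr (r%:C *: x) = `|r| * nr x.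
Proof. by rewrite nrZ nr_real. Qed.

End RealNormScale.

Section Hilb.
Variables (R : realType) (H : hilbertType R).
Implicit Types (x y z : H) (k : R[i]).

Lemma ipDl x y z : inner (x + y) z = inner x z + inner y z.
Proof. exact: linearDl. Qed.
Lemma ipZl k x z : inner (k *: x) z = k * inner x z.
Proof. exact: linearZl_LR. Qed.
Lemma ipC x y : inner x y = Num.conj (inner y x).
Proof. by rewrite [LHS]hermC expr0 mul1r. Qed.
Lemma ipDr x y z : inner z (x + y) = inner z x + inner z y.
Proof. exact: linearDr. Qed.
Lemma ipZr k x z : inner z (k *: x) = Num.conj k * inner z x.
Proof. exact: linearZr_LR. Qed.
Lemma ip0l x : inner 0 x = 0. Proof. exact: linear0l. Qed.
Lemma ip0r x : inner x 0 = 0. Proof. exact: linear0r. Qed.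
Lemma ipBl x y z : inner (x - y) z = inner x z - inner y z.
Proof. exact: linearBl. Qed.
Lemma ipBr x y z : inner z (x - y) = inner z x - inner z y.
Proof. exact: linearBr. Qed.
Lemma ip_nr x : inner x x = (nr x ^+ 2)%:C.
Proof. by rewrite -inner_norm nrE rmorphXn. Qed.

Lemma ip_eq0 x : inner x x = 0 -> x = 0.
Proof.
rewrite ip_nr => /(@complexI _ _ 0) /eqP; rewrite sqrf_eq0 => /eqP; exact: nr_eq0.
Qed.

Lemma ip_ge0 x : 0 <= inner x x.
Proof. by rewrite ip_nr ler0c sqr_ge0. Qed.

Lemma nr_inner x y : nr (inner x y : R[i]^o) <= nr x * nr y.
Proof.
have [->|/eqP /nr_gt0 y0] := eqVneq y 0; first by rewrite ip0r !nr0 mulr0.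
pose c : R[i] := inner x y; pose d : R[i] := (nr y ^+ 2)%:C.
have d0 : d != 0.
  by rewrite /d -[0](rmorph0 (real_complex R)) (inj_eq (@complexI _)) sqrf_eq0 gt_eqF.
have := ip_ge0 (d *: x - c *: y).
have dr : Num.conj d = d by apply/CrealP; rewrite realE lecR exprn_ge0 // nr_ge0.
rewrite !(ipBl, ipBr, ipZl, ipZr) dr (ipC y x) -/c (ip_nr y) -/d.
have -> : d * (d * inner x x - Num.conj c * c) - c * (d * Num.conj c - Num.conj c * d)
   = d * (d * inner x x - c * Num.conj c) by ring.
rewrite ip_nr -normCK nrE -rmorphXn -!rmorphM -rmorphB -rmorphM ler0c.
rewrite pmulr_rge0 ?exprn_gt0 // subr_ge0 => h.
rewrite -(@ler_pXn2r _ 2) ?nnegrE ?mulr_ge0 ?nr_ge0 //.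
by rewrite exprMn mulrC.
Qed.

Lemma nr_orth x y : inner x y = 0 -> nr (x + y) = nr (x - y).
Proof.
move=> xy; apply/eqP; rewrite -(@eqrXn2 _ 2) ?nr_ge0 //; apply/eqP/complexI.
rewrite -!ip_nr !(ipBl, ipBr, ipDl, ipDr) (ipC y x) xy rmorph0.
by rewrite !subr0 !addr0 sub0r opprK add0r.
Qed.

Lemma closed_approx (P : set H) :
  (forall x, (forall e : R, 0 < e -> exists y, P y /\ nr (x - y) < e) -> P x) ->
  closed P.
Proof.
move=> h x cx; apply: h => e e0.
have [|y [Py]] := cx (ball x e%:C); first by apply: nbhsx_ballx; rewrite ltcR.
by rewrite -ball_normE /= nrE ltcR => xy; exists y.
Qed.
End Hilb.

(** * Rules of calculation in a C*-algebra *)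

Section CStarBasics.
Variables (R : realType) (A : cstarAlgType R).
Implicit Types (a b c x y : A) (k : R[i]).
Local Notation "a ** b" := (cmul a b) (at level 40, left associativity).

Lemma cmulDl a b c : (a + b) ** c = a ** c + b ** c.
Proof. by have := cmul_linearl c 1 a b; rewrite !scale1r. Qed.
Lemma cmulDr a b c : c ** (a + b) = c ** a + c ** b.
Proof. by have := cmul_linearr c 1 a b; rewrite !scale1r. Qed.
Lemma cmul0l c : 0 ** c = 0.
Proof. by apply: (addIr (0 ** c)); rewrite -cmulDl !add0r. Qed.
Lemma cmul0r c : c ** 0 = 0.
Proof. by apply: (addIr (c ** 0)); rewrite -cmulDr !add0r. Qed.
Lemma cmulZl k a c : (k *: a) ** c = k *: (a ** c).
Proof. by have := cmul_linearl c k a 0; rewrite !addr0 cmul0l addr0. Qed.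
Lemma cmulZr k a c : c ** (k *: a) = k *: (c ** a).
Proof. by have := cmul_linearr c k a 0; rewrite !addr0 cmul0r addr0. Qed.
Lemma cmulNl a c : (- a) ** c = - (a ** c).
Proof. by rewrite -scaleN1r cmulZl scaleN1r. Qed.
Lemma cmulNr a c : c ** (- a) = - (c ** a).
Proof. by rewrite -scaleN1r cmulZr scaleN1r. Qed.
Lemma cmulBl a b c : (a - b) ** c = a ** c - b ** c.
Proof. by rewrite cmulDl cmulNl. Qed.
Lemma cmulBr a b c : c ** (a - b) = c ** a - c ** b.
Proof. by rewrite cmulDr cmulNr. Qed.

Lemma cadjD a b : cadj (a + b) = cadj a + cadj b.
Proof. by have := cadj_antilinear 1 a b; rewrite rmorph1 !scale1r. Qed.
Lemma cadj0 : cadj (0 : A) = 0.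
Proof. by apply: (addIr (cadj (0 : A))); rewrite -cadjD !add0r. Qed.
Lemma cadjZ k a : cadj (k *: a) = Num.conj k *: cadj a.
Proof. by have := cadj_antilinear k a 0; rewrite !addr0 cadj0 addr0. Qed.
Lemma cadjN a : cadj (- a) = - cadj a.
Proof. by rewrite -scaleN1r cadjZ rmorphN rmorph1 scaleN1r. Qed.
Lemma cadjB a b : cadj (a - b) = cadj a - cadj b.
Proof. by rewrite cadjD cadjN. Qed.

Lemma nrM a b : nr (a ** b) <= nr a * nr b.
Proof. by rewrite -lecR rmorphM /= -!nrE cmul_norm. Qed.
Lemma nr_star a : nr (cadj a ** a) = nr a ^+ 2.
Proof. by apply: complexI; rewrite rmorphXn /= -!nrE cstar_identity. Qed.
Lemma nr_adj a : nr (cadj a) = nr a.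
Proof.
have le b : nr b <= nr (cadj b).
  have [->|/eqP /nr_gt0 b0] := eqVneq b 0; first by rewrite cadj0.
  by rewrite -(ler_pM2r b0) -expr2 -nr_star nrM.
by apply/eqP; rewrite eq_le le andbT -{2}(cadjK a) le.
Qed.
End CStarBasics.

(** * The unitization *)

(** Units are adjoined even if [A] has one: a pair then has a well defined scalar
    part, whose vanishing characterizes [A]. *)
Definition unitz (R : realType) (A : cstarAlgType R) : Type := (R[i]^o * A)%type.

Section Unitization.
Variables (R : realType) (A : cstarAlgType R).
Local Notation U := (unitz A).
HB.instance Definition _ := GRing.Lmodule.copy U (R[i]^o * A)%type.

Definition umul (S T : U) : U :=
  (S.1 * T.1, S.1 *: T.2 + T.1 *: S.2 + cmul S.2 T.2).
Definition uone : U := (1, 0).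

Fact umulA : associative umul.
Proof.
move=> [r a] [s b] [t c]; congr pair => /=; first by rewrite mulrA.
rewrite !(scalerDr, cmulDl, cmulDr, cmulZl, cmulZr, scalerA, cmulA).
rewrite !addrA (mulrC t r) (mulrC t s).
rewrite -!addrA; congr (_ + (_ + _)); rewrite !addrA; congr (_ + _).
by rewrite [LHS](ACl (2*4*1*3)).
Qed.
Fact umul1l : left_id uone umul.
Proof. by move=> [r a]; congr pair => /=; rewrite ?mul1r // scale1r scaler0 cmul0l !addr0. Qed.
Fact umul1r : right_id uone umul.
Proof. by move=> [r a]; congr pair => /=; rewrite ?mulr1 // scale1r scaler0 cmul0r addr0 add0r. Qed.
Fact umulDl : left_distributive umul +%R.
Proof.
move=> [r a] [s b] [t c]; congr pair => /=; first by rewrite mulrDl.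
by rewrite scalerDl scalerDr cmulDl !addrA [LHS](ACl (1*3*5*2*4*6)).
Qed.
Fact umulDr : right_distributive umul +%R.
Proof.
move=> [r a] [s b] [t c]; congr pair => /=; first by rewrite mulrDr.
by rewrite scalerDl scalerDr cmulDr !addrA [LHS](ACl (1*3*5*2*4*6)).
Qed.
Fact uone_neq0 : uone != 0.
Proof. by apply/eqP => -[]; apply/eqP; rewrite oner_eq0. Qed.
HB.instance Definition _ := GRing.Zmodule_isNzRing.Build U
  umulA umul1l umul1r umulDl umulDr uone_neq0.
Fact uscalerAl (k : R[i]) (S T : U) : k *: (S * T) = (k *: S) * T.
Proof.
congr pair => /=; first by rewrite [LHS]mulrA.
by rewrite !scalerDr cmulZl !scalerA; congr (_ + _ *: _ + _); rewrite mulrC.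
Qed.
HB.instance Definition _ := GRing.Lmodule_isLalgebra.Build R[i] U uscalerAl.
Fact uscalerAr (k : R[i]) (S T : U) : k *: (S * T) = S * (k *: T).
Proof.
congr pair => /=; first by rewrite [LHS]mulrCA.
by rewrite !scalerDr cmulZr !scalerA; congr (_ *: _ + _ + _); rewrite mulrC.
Qed.
HB.instance Definition _ := GRing.Lalgebra_isAlgebra.Build R[i] U uscalerAr.

Definition emb (a : A) : U := (0, a).
Definition ustar (T : U) : U := (Num.conj T.1, cadj T.2).

Lemma embD a b : emb (a + b) = emb a + emb b.
Proof. by congr pair; rewrite addr0. Qed.
Lemma embZ k a : emb (k *: a) = k *: emb a.
Proof. by congr pair; rewrite scaler0. Qed.
Lemma embN a : emb (- a) = - emb a.
Proof. by congr pair; rewrite oppr0. Qed.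
Lemma embB a b : emb (a - b) = emb a - emb b.
Proof. by rewrite embD embN. Qed.
Lemma emb0 : emb 0 = 0. Proof. by []. Qed.
Lemma embM a b : emb (cmul a b) = emb a * emb b.
Proof. by congr pair => /=; rewrite ?mulr0 // !scale0r !add0r. Qed.
Lemma emb_inj : injective emb.
Proof. by move=> a b []. Qed.
Lemma embE (T : U) : T.1 = 0 -> T = emb T.2.
Proof. by case: T => r a /= ->. Qed.
Lemma fstM (S T : U) : (S * T).1 = S.1 * T.1. Proof. by []. Qed.
Lemma mul_emb1 (T : U) a : (T * emb a).1 = 0.
Proof. exact: mulr0. Qed.
Lemma mul_embE (T : U) a : T * emb a = emb (T * emb a).2.
Proof. by apply: embE; rewrite mul_emb1. Qed.

Lemma ustarK : involutive ustar.
Proof. by move=> [r a]; congr pair => /=; rewrite ?conjCK ?cadjK. Qed.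
Lemma ustarD S T : ustar (S + T) = ustar S + ustar T.
Proof. by congr pair => /=; rewrite ?rmorphD ?cadjD. Qed.
Lemma ustarZ k T : ustar (k *: T) = Num.conj k *: ustar T.
Proof. by congr pair => /=; rewrite ?cadjZ // rmorphM. Qed.
Lemma ustarN T : ustar (- T) = - ustar T.
Proof. by congr pair => /=; rewrite ?rmorphN ?cadjN. Qed.
Lemma ustarB S T : ustar (S - T) = ustar S - ustar T.
Proof. by rewrite ustarD ustarN. Qed.
Lemma ustarM S T : ustar (S * T) = ustar T * ustar S.
Proof.
congr pair => /=; first by rewrite rmorphM mulrC.
by rewrite !cadjD !cadjZ cadjM [X in X + _ = _]addrC.
Qed.
Lemma ustar1 : ustar 1 = 1.
Proof. by congr pair => /=; rewrite ?rmorph1 ?cadj0. Qed.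
Lemma ustar_emb a : ustar (emb a) = emb (cadj a).
Proof. by congr pair => /=; rewrite rmorph0. Qed.

(** The norm of a pair is the maximum of the modulus of its scalar part and of its
    norm as a left multiplier of [A]. The scalar part makes it faithful when [A]
    has a unit of its own. Only upper bounds for it are ever used. *)
Definition bnd (T : U) (r : R) : Prop :=
  nr T.1 <= r /\ forall x : A, nr (T * emb x).2 <= r * nr x.

Lemma bnd_ge0 T r : bnd T r -> 0 <= r.
Proof. by move=> [h _]; exact: le_trans (nr_ge0 _) h. Qed.
Lemma bndW T r s : r <= s -> bnd T r -> bnd T s.
Proof.
move=> rs [h1 h2]; split => [|x]; first exact: le_trans h1 rs.
by apply: le_trans (h2 x) _; rewrite ler_wpM2r ?nr_ge0.
Qed.
Lemma bndD S T r s : bnd S r -> bnd T s -> bnd (S + T) (r + s).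
Proof.
move=> [h1 h2] [k1 k2]; split => [|x]; first exact: le_trans (nrD _ _) (lerD h1 k1).
rewrite [(S + T) * _]mulrDl [(r + s) * _]mulrDl; apply: le_trans (nrD _ _) _.
exact: lerD.
Qed.
Lemma bndZ k T r : bnd T r -> bnd (k *: T) (nr (k : R[i]^o) * r).
Proof.
move=> [h1 h2]; split => [|x].
  by rewrite [X in X <= _]nrZ; apply: ler_wpM2l h1; exact: nr_ge0.
rewrite -scalerAl [nr _]nrZ -mulrA; apply: ler_wpM2l (h2 x); exact: nr_ge0.
Qed.
Lemma bndN T r : bnd T r -> bnd (- T) r.
Proof.
move=> [h1 h2]; split => [|x]; first by rewrite [X in X <= _]nrN.
by rewrite mulNr [X in X <= _]nrN.
Qed.
Lemma bndB S T r s : bnd S r -> bnd T s -> bnd (S - T) (r + s).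
Proof. by move=> h /bndN; exact: bndD. Qed.
Lemma bndM S T r s : bnd S r -> bnd T s -> bnd (S * T) (r * s).
Proof.
move=> hS; have r0 := bnd_ge0 hS; case: hS => [h1 h2] [k1 k2]; split => [|x].
  by rewrite fstM [X in X <= _]nrZ ler_pM ?nr_ge0.
rewrite -mulrA mul_embE -mulrA; apply: le_trans (h2 _) _.
by rewrite ler_wpM2l.
Qed.
Lemma bnd_emb a r : nr a <= r -> bnd (emb a) r.
Proof.
move=> h; have r0 := le_trans (nr_ge0 a) h; split => [|x]; first by rewrite /= nr0.
by rewrite -embM /=; apply: le_trans (nrM _ _) _; rewrite ler_wpM2r ?nr_ge0.
Qed.
Lemma bnd1 : bnd 1 1.
Proof.
split => [|x]; last by rewrite !mul1r.
by rewrite (_ : (1 : U).1 = 1%:C) // nr_real normr1.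
Qed.
(** Multiplying T by the adjoint of its part in [A] recovers the norm of that part
    up to the scalar part. *)
Lemma bnd_nr T r : bnd T r -> nr T.2 <= 2 * r.
Proof.
move=> hT; have r0 := bnd_ge0 hT; case: hT => h1 h2.
have [->|/eqP /nr_gt0 x0] := eqVneq T.2 0; first by rewrite nr0 mulr_ge0.
have := h2 (cadj T.2); rewrite /= scale0r addr0 => h.
have e : cmul T.2 (cadj T.2) = (T.1 *: cadj T.2 + cmul T.2 (cadj T.2)) - T.1 *: cadj T.2.
  by rewrite addrAC subrr add0r.
have : nr (cmul T.2 (cadj T.2)) <= 2 * r * nr T.2.
  rewrite e; apply: le_trans (nrB _ _) _; rewrite nr_adj in h.
  rewrite -mulrA mulr_natl mulr2n; apply: lerD h _; rewrite nrZ nr_adj.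
  by apply: ler_wpM2r h1; exact: nr_ge0.
rewrite -{1}(cadjK T.2) nr_star nr_adj expr2 ler_pM2r //.
Qed.
Lemma bnd_emb_nr a r : bnd (emb a) r -> nr a <= r.
Proof.
move=> [h1 h2]; have r0 := le_trans (nr_ge0 _) h1.
have [->|/eqP /nr_gt0 x0] := eqVneq a 0; first by rewrite nr0.
have := h2 (cadj a); rewrite -embM /= -{1}(cadjK a) nr_star nr_adj expr2 ler_pM2r //.
Qed.

(** The C*-identity: the square of the norm of T x is the norm of x^* (T^* T x), by
    the C*-identity in [A]. *)
Lemma bnd_star T r : 0 <= r -> bnd (ustar T * T) (r ^+ 2) -> bnd T r.
Proof.
move=> r0 [h1 h2]; split => [|x].
  rewrite -(@ler_pXn2r _ 2) ?nnegrE ?nr_ge0 //; apply: le_trans h1.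
  rewrite fstM /= [X in _ <= X]nrZ expr2 ler_wpM2r ?nr_ge0 //.
  by rewrite -lecR -!nrE norm_conjC.
rewrite -(@ler_pXn2r _ 2) ?nnegrE ?nr_ge0 ?mulr_ge0 ?nr_ge0 //.
rewrite -nr_star; set y := (T * emb x).2.
have -> : cmul (cadj y) y = (emb (cadj x) * (ustar T * T * emb x)).2.
  rewrite -[LHS]/((emb (cmul (cadj y) y)).2) embM -ustar_emb /y -mul_embE.
  by rewrite ustarM ustar_emb !mulrA.
rewrite mul_embE -embM /=; apply: le_trans (nrM _ _) _.
rewrite nr_adj mulrC exprMn [nr x ^+ 2]expr2 mulrA; apply: ler_wpM2r (h2 x).
exact: nr_ge0.
Qed.

Lemma bnd_unitary T : ustar T * T = 1 -> bnd T 1.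
Proof. by move=> h; apply: bnd_star => //; rewrite h expr1n; exact: bnd1. Qed.

End Unitization.

(** * Sequences whose steps are dominated by a real sequence *)

Section Majorant.

Lemma cauchy_seq_lim (K : numFieldType) (V : completeNormedModType K) (u : nat -> V) :
  (forall e : K, 0 < e ->
     exists N, forall m n, (N <= m)%N -> (N <= n)%N -> `|u m - u n| < e) ->
  exists l, forall e : K, 0 < e -> exists N, forall m, (N <= m)%N -> `|u m - l| < e.
Proof.
move=> uC.
have : cvg (u @ \oo).
  apply: cauchy_cvg; apply/cauchy_ballP => e e0.
  have [N uN] := uC e e0.
  exists (u @` [set n | (N <= n)%N], u @` [set n | (N <= n)%N]) => /=.
    by split; exists N => // n Nn; exists n.
  move=> [_ _] /= [[m Nm <-] [n Nn <-]].
  by rewrite -ball_normE /=; apply: uN.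
move=> /cvg_ex[l ul]; exists l => e e0.
move/cvgrPdist_lt : ul => /(_ e e0) [N _ uN]; exists N => m Nm.
by rewrite distrC; exact: uN.
Qed.

Lemma dist_majorant (K : numFieldType) (V : normedModType K) (u : nat -> V) (t : nat -> K) :
  (forall j, `|u j.+1 - u j| <= t j.+1 - t j) ->
  forall n m, (n <= m)%N -> `|u m - u n| <= t m - t n.
Proof.
move=> ut n m /subnKC <-; elim: (m - n)%N => [|k IH].
  by rewrite addn0 !subrr normr0.
rewrite addnS -(subrK (u (n + k)%N) (u (n + k).+1)) -addrA.
apply: le_trans (ler_normD _ _) _.
by apply: le_trans (lerD (ut _) IH) _; rewrite addrA subrK.
Qed.

Lemma majorant_lim (K : numFieldType) (V : completeNormedModType K) (u : nat -> V)
    (t : nat -> K) (s : K) :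
  (forall j, `|u j.+1 - u j| <= t j.+1 - t j) -> (forall j, t j <= s) ->
  (forall e, 0 < e -> exists N, s - t N < e) ->
  exists l, forall j, `|u j - l| <= s - t j.
Proof.
move=> ut ts tN; have tele := dist_majorant ut.
have [e e0|l ul] := @cauchy_seq_lim K V u.
  have [N tNe] := tN (e / 2) (divr_gt0 e0 (ltr0Sn _ 1)); exists N => m n Nm Nn.
  rewrite (splitr e); apply: le_lt_trans (ler_distD (u N) _ _) _.
  rewrite [X in _ + X]distrC; apply: ltrD.
    by apply: le_lt_trans (tele _ _ Nm) (le_lt_trans _ tNe); rewrite lerD2r.
  by apply: le_lt_trans (tele _ _ Nn) (le_lt_trans _ tNe); rewrite lerD2r.
exists l => j; apply/ler_addgt0Pr => e e0.
have [N uN] := ul e e0; pose m := maxn N j.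
apply: le_trans (ler_distD (u m) _ _) _; apply: lerD.
  rewrite distrC; apply: le_trans (tele _ _ (leq_maxr N j)) _.
  by rewrite lerD2r.
exact/ltW/uN/leq_maxl.
Qed.

Variable R : realType.

Lemma nondecreasing_sup (t : nat -> R) (M : R) :
  (forall j, t j <= t j.+1) -> (forall j, t j <= M) ->
  exists s, [/\ s <= M, forall j, t j <= s & forall e, 0 < e -> exists N, s - t N < e].
Proof.
move=> tS tM; have hs : has_sup (range t).
  by split; [exists (t 0), 0 | exists M => _ [j _ <-]].
exists (sup (range t)); split => [|j|e e0].
- by apply: ge_sup => [|_ [j _ <-]//]; exists (t 0), 0.
- by apply: ub_le_sup; [exists M => _ [k _ <-] | exists j].
- have [_ [N _ <-] h] := sup_adherent e0 hs; exists N.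
  by rewrite ltrBlDr -ltrBlDl.
Qed.

(** The form in which all passages to the limit are made. *)
Lemma le_small (x y C : R) (d : nat -> R) : 0 <= C ->
  (forall e, 0 < e -> exists N, d N < e) -> (forall j, x <= y + C * d j) -> x <= y.
Proof.
move=> C0 dN h; apply/ler_addgt0Pr => e e0.
have C1 : 0 < C + 1 by rewrite ltr_wpDl.
have [N dNe] := dN (e / (C + 1)) (divr_gt0 e0 C1).
apply: le_trans (h N) _; rewrite lerD2l.
apply: le_trans (ler_wpM2l C0 (ltW dNe)) _.
by rewrite mulrCA ger_pMr // ler_pdivrMr // mul1r lerDl.
Qed.

Lemma nr_majorant_lim (V : completeNormedModType R[i]) (u : nat -> V)
    (t : nat -> R) (s : R) :
  (forall j, nr (u j.+1 - u j) <= t j.+1 - t j) -> (forall j, t j <= s) ->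
  (forall e, 0 < e -> exists N, s - t N < e) ->
  exists l, forall j, nr (u j - l) <= s - t j.
Proof.
move=> ut ts tN.
have [j|j|e e0|l ul] := @majorant_lim _ V u (fun j => (t j)%:C) s%:C.
- by rewrite nrE -rmorphB lecR.
- by rewrite lecR.
- have e0' : 0 < complex.Re e by rewrite -ltcR RRe_real ?gtr0_real.
  have [N h] := tN _ e0'; exists N.
  by rewrite -rmorphB -[e]RRe_real ?gtr0_real // ltcR.
- by exists l => j; have := ul j; rewrite nrE -rmorphB lecR.
Qed.

Lemma ler_Re_nr (z : R[i]) : `|complex.Re z| <= nr (z : R[i]^o).
Proof.
rewrite -lecR -nrE normc_def lecR -sqrtr_sqr ler_wsqrtr // lerDl sqr_ge0 //.
Qed.
Lemma ler_Im_nr (z : R[i]) : `|complex.Im z| <= nr (z : R[i]^o).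
Proof.
rewrite -lecR -nrE normc_def lecR -sqrtr_sqr ler_wsqrtr // lerDr sqr_ge0 //.
Qed.
Lemma nr_le_ReIm (z : R[i]) : nr (z : R[i]^o) <= `|complex.Re z| + `|complex.Im z|.
Proof.
have hi : nr ('i : R[i]^o) = 1.
  by apply: complexI; rewrite -nrE normc_def /= expr0n expr1n add0r sqrtr1.
rewrite {1}[z]complexE; apply: le_trans (nrD _ _) _.
by rewrite nr_real lerD2l (nrZ 'i ((complex.Im z)%:C : R[i]^o)) hi mul1r nr_real.
Qed.

Lemma complex_majorant_lim (u : nat -> R[i]^o) (t : nat -> R) (s : R) :
  (forall j, nr (u j.+1 - u j) <= t j.+1 - t j) -> (forall j, t j <= s) ->
  (forall e, 0 < e -> exists N, s - t N < e) ->
  exists l : R[i]^o, forall j, nr (u j - l) <= 2 * (s - t j).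
Proof.
move=> ut ts tN.
have [j||//|x ux] := @majorant_lim _ R (fun j => complex.Re (u j)) t s => //.
  by apply: le_trans (ut j); rewrite -raddfB ler_Re_nr.
have [j||//|y uy] := @majorant_lim _ R (fun j => complex.Im (u j)) t s => //.
  by apply: le_trans (ut j); rewrite -raddfB ler_Im_nr.
exists (x +i* y) => j; apply: le_trans (nr_le_ReIm _) _.
rewrite mulr_natl mulr2n; apply: lerD.
  by have := ux j; case: (u j).
by have := uy j; case: (u j).
Qed.

End Majorant.

(** * Square roots and absolute values *)

Section SquareRoots.
Variables (R : realType) (A : cstarAlgType R).
Local Notation U := (unitz A).
Implicit Types S T W K P : U.

Lemma bnd_parts T r s : nr T.1 <= r -> nr T.2 <= s -> bnd T (r + s).
Proof.
move=> h1 h2; have -> : T = T.1 *: 1 + emb T.2.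
  case: T h1 h2 => c a _ _; congr pair; rewrite /= ?addr0 ?[RHS]mulr1 //.
  by rewrite scaler0 add0r.
apply: bndD (bnd_emb h2); have /bndW := bndZ T.1 (bnd1 A); apply.
by rewrite mulr1.
Qed.

Lemma bnd_exists T : exists r, bnd T r.
Proof. by exists (nr T.1 + nr T.2); exact: bnd_parts. Qed.

Lemma bnd_ustar3 T r : bnd T r -> bnd (ustar T) (3 * r).
Proof.
move=> hT; have h2 := bnd_nr hT; case: hT => h1 _.
rewrite (_ : 3 * r = r + 2 * r); last by ring.
apply: bnd_parts; last by rewrite /= nr_adj.
by apply: le_trans h1; rewrite /= -lecR -!nrE norm_conjC.
Qed.

Lemma bnd0P T : bnd T 0 -> T = 0.
Proof.
move=> hT; have h2 := bnd_nr hT; case: hT => h1 _; rewrite mulr0 in h2.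
case: T h1 h2 => c a /= h1 h2.
by congr pair; apply/nr_eq0/eqP; rewrite eq_le nr_ge0 andbT.
Qed.

Lemma bnd_small T r C (d : nat -> R) : 0 <= C ->
  (forall e, 0 < e -> exists N, d N < e) -> (forall j, bnd T (r + C * d j)) -> bnd T r.
Proof.
move=> C0 dN h; split => [|x].
  by apply: le_small C0 dN _ => j; case: (h j).
apply: (@le_small _ _ _ (C * nr x) d); first by rewrite mulr_ge0 ?nr_ge0.
  exact: dN.
by move=> j; rewrite mulrAC -mulrDl; case: (h j) => _; exact.
Qed.

(** The limit is taken separately in the scalars and in [A], which costs the
    constant 4. *)
Lemma unitz_majorant_lim (u : nat -> U) (t : nat -> R) (s : R) :
  (forall j, bnd (u j.+1 - u j) (t j.+1 - t j)) -> (forall j, t j <= s) ->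
  (forall e, 0 < e -> exists N, s - t N < e) ->
  exists l : U, forall j, bnd (u j - l) (4 * (s - t j)).
Proof.
move=> ut ts tN.
have [j|c uc] := @complex_majorant_lim R (fun j => (u j).1) t s _ ts tN.
  by case: (ut j).
have [j|j|e e0|a ua] := @nr_majorant_lim R A (fun j => (u j).2) (fun j => 2 * t j) (2 * s).
- by rewrite -mulrBr; exact: bnd_nr (ut j).
- by rewrite ler_pM2l.
- have [N h] := tN _ (divr_gt0 e0 (ltr0Sn _ 1)); exists N.
  by rewrite -mulrBr mulrC -ltr_pdivlMr.
exists (c, a) => j.
rewrite (_ : 4 * (s - t j) = 2 * (s - t j) + (2 * s - 2 * t j)); last by ring.
by apply: bnd_parts; [exact: uc | exact: ua].
Qed.

Definition half : R[i] := (2^-1 : R)%:C.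

Lemma half_double (V : lmodType R[i]) (x : V) : half *: (x + x) = x.
Proof.
rewrite -mulr2n -scaler_nat scalerA (_ : half * 2%:R = 1) ?scale1r //.
by rewrite /half -(rmorph_nat (real_complex R)) -rmorphM mulVf // pnatr_eq0.
Qed.

Lemma bnd_half T r : bnd T r -> bnd (half *: T) (r / 2).
Proof.
move=> h; apply: bndW (bndZ half h).
by rewrite nr_real ger0_norm ?invr_ge0 // mulrC.
Qed.

Lemma conj_half : Num.conj half = half.
Proof. by apply/CrealP; rewrite realE /half lecR invr_ge0 ler0n. Qed.

Fixpoint sqrt_iter K j : U :=
  if j is j'.+1 then half *: (K + sqrt_iter K j' * sqrt_iter K j') else 0.
(** The scalar iteration for K = 1, which dominates [sqrt_iter] step by step. *)
Fixpoint sqrt_maj j : R :=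
  if j is j'.+1 then (1 + sqrt_maj j' * sqrt_maj j') / 2 else 0.

Lemma sqrt_maj_ge0 j : 0 <= sqrt_maj j.
Proof. by case: j => //= j; rewrite divr_ge0 // addr_ge0 // -expr2 sqr_ge0. Qed.
Lemma sqrt_maj_le1 j : sqrt_maj j <= 1.
Proof.
elim: j => [|j IH] /=; first exact: ler01.
have := sqrt_maj_ge0 j; nra.
Qed.
Lemma sqrt_maj_nd j : sqrt_maj j <= sqrt_maj j.+1.
Proof. by rewrite /=; have := sqr_ge0 (1 - sqrt_maj j); lra. Qed.

(** As polynomials in K, the iterates and their successive differences have
    nonnegative coefficients, so their norms are at most their values at K = 1,
    which form a bounded nondecreasing sequence. In this way convergence is
    obtained up to norm 1, where the map P |-> (K + P^2)/2 is not a contraction. *)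
Lemma sqrt_fixpoint K : ustar K = K -> bnd K 1 ->
  exists P, [/\ bnd P 1, ustar P = P, P + P = K + P * P &
    forall Y, Y * K = K * Y -> Y * P = P * Y].
Proof.
move=> Ks K1; set u := sqrt_iter K; set t := sqrt_maj.
have ub j : bnd (u j) (t j).
  elim: j => [|j IH] /=; first by rewrite /u /= -emb0; apply: bnd_emb; rewrite nr0.
  by apply: bnd_half; apply: bndD => //; apply: bndM.
have ud j : bnd (u j.+1 - u j) (t j.+1 - t j).
  elim: j => [|j IH]; first by rewrite [u 0]/= [t 0]/= !subr0; exact: ub.
  have -> : u j.+2 - u j.+1 =
      half *: ((u j.+1 - u j) * u j.+1 + u j * (u j.+1 - u j)).
    rewrite [u j.+2]/= [X in _ - X]/= -/(u j.+1) -/(u j) -scalerBr; congr (_ *: _).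
    by rewrite mulrBl mulrBr opprD addrACA subrr add0r addrA subrK.
  have -> : t j.+2 - t j.+1 =
      ((t j.+1 - t j) * t j.+1 + t j * (t j.+1 - t j)) / 2.
    by rewrite /t /=; field.
  by apply/bnd_half/bndD; apply: bndM.
have [s [s1 ts tN]] := nondecreasing_sup sqrt_maj_nd sqrt_maj_le1.
have [P uP] := unitz_majorant_lim ud ts tN.
have uP' j : bnd (P - u j) (4 * (s - t j)) by rewrite -opprB; apply: bndN.
have P1 : bnd P 1.
  apply: (@bnd_small P 1 4 _ _ tN) => // j; rewrite -(subrK (u j) P) addrC.
  by apply: bndD => //; apply: bndW (ub j); exact: sqrt_maj_le1.
have us j : ustar (u j) = u j.
  elim: j => [|j IH]; first by rewrite /u /= -emb0 ustar_emb cadj0.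
  by rewrite /u /= -/(u j) ustarZ ustarD ustarM Ks IH conj_half.
have zero T C : 0 <= C -> (forall j, bnd T (C * (s - t j))) -> T = 0.
  by move=> C0 h; apply/bnd0P/(bnd_small C0 tN) => j; rewrite add0r.
exists P; split => //.
- apply: subr0_eq; apply: (zero _ 16) => // j.
  have -> : ustar P - P = ustar (P - u j) - (P - u j).
    by rewrite ustarB us opprB addrA subrK.
  rewrite (_ : 16 * _ = 3 * (4 * (s - t j)) + 4 * (s - t j)); last by ring.
  by apply: bndB => //; exact: bnd_ustar3.
- apply: subr0_eq; apply: (zero _ 16) => // j.
  have -> : P + P - (K + P * P) = ((P - u j.+1) + (P - u j.+1)) -
       ((P - u j) * P + u j * (P - u j)).
    have e : u j.+1 + u j.+1 = K + u j * u j.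
      by rewrite /u /= -/(u j) -scalerDr half_double.
    rewrite mulrBl mulrBr [X in _ = _ - X]addrA subrK [X in _ = X - _]addrACA.
    by rewrite -opprD e !opprD opprK !addrA [RHS](ACl (1*2*3*5*4*6)) /= subrK.
  have tj := sqrt_maj_nd j; rewrite -/t in tj.
  apply: (@bndW _ _ _ ((4 * (s - t j) + 4 * (s - t j)) + (4 * (s - t j) * 1 + 1 * (4 * (s - t j))))).
    by lra.
  have le1 : 4 * (s - t j.+1) <= 4 * (s - t j) by rewrite ler_pM2l // lerB.
  apply: bndB; first by apply: bndD; exact: bndW (uP' j.+1).
  by apply: bndD; apply: bndM => //; apply: bndW (ub j); exact: sqrt_maj_le1.
- move=> Y YK; apply: subr0_eq; have [r Yr] := bnd_exists Y.
  apply: (zero _ (8 * r)) => [|j]; first by rewrite mulr_ge0 // (bnd_ge0 Yr).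
  have Yu : Y * u j = u j * Y.
    elim: j => [|j IH]; first by rewrite /u /= mulr0 mul0r.
    rewrite /u /= -/(u j) -scalerAr -scalerAl mulrDr mulrDl YK; congr (_ *: (_ + _)).
    by rewrite mulrA IH -mulrA IH mulrA.
  have -> : Y * P - P * Y = Y * (P - u j) - (P - u j) * Y.
    by rewrite mulrBr mulrBl Yu opprB addrA subrK.
  rewrite (_ : 8 * r * _ = r * (4 * (s - t j)) + (4 * (s - t j)) * r); last by ring.
  by apply: bndB; exact: bndM.
Qed.

End SquareRoots.

Section Contractions.
Variables (R : realType) (A : cstarAlgType R).
Local Notation U := (unitz A).
Implicit Types S T W K P : U.

Lemma sqrt_exists K : ustar K = K -> bnd K 1 ->
  exists W, [/\ bnd (1 - W) 1, ustar W = W, W * W = 1 - K &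
    forall Y, Y * K = K * Y -> Y * W = W * Y].
Proof.
move=> Ks K1; have [P [P1 Ps PE Pc]] := sqrt_fixpoint Ks K1.
exists (1 - P); split.
- by rewrite opprB addrC subrK.
- by rewrite ustarB ustar1 Ps.
- have -> : K = P + P - P * P by rewrite PE addrK.
  by rewrite mulrBl mul1r mulrBr mulr1 !opprB opprD !addrA [LHS](ACl (1*3*2*4)).
- by move=> Y /Pc YP; rewrite mulrBl mulrBr YP mul1r mulr1.
Qed.

Lemma conj_i : Num.conj ('i : R[i]) = - 'i.
Proof. by apply/eqP; rewrite eq_complex /= oppr0 !eqxx. Qed.

(** With W a square root of 1 - T^2, the element u = T + iW is unitary. So W is
    a mean of unitaries, and so is 2 T^2 - 1 = (u^2 + u^-2) / 2. *)
Lemma bnd_sqr1 T : ustar T = T -> bnd T 1 ->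
  bnd (1 - T * T) 1 /\ bnd (T * T + T * T - 1) 1.
Proof.
move=> Ts T1.
have [||W [_ Ws WW Wc]] := @sqrt_exists (T * T); first by rewrite ustarM Ts.
  by rewrite -[1](mulr1 1); apply: bndM.
have TW : T * W = W * T by apply: Wc; rewrite mulrA.
pose V := 'i *: W; have TV : T * V = V * T by rewrite /V -scalerAl -scalerAr TW.
have VV : V * V = - (1 - T * T).
  by rewrite /V -scalerAl -scalerAr scalerA -expr2 sqr_i scaleN1r WW.
have Vs : ustar V = - V by rewrite ustarZ Ws conj_i scaleNr.
pose u := T + V; pose v := T - V.
have us : ustar u = v by rewrite ustarD Ts Vs.
have vs : ustar v = u by rewrite ustarB Ts Vs opprK.
have vu : v * u = 1.
  rewrite /u /v mulrDr !mulrBl VV opprK TV; rewrite addrA subrK.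
  by rewrite addrC subrK.
have uv : u * v = 1.
  rewrite /u /v mulrBr !mulrDl VV TV; rewrite opprD opprK addrA addrK.
  by rewrite addrC subrK.
have u1 : bnd u 1 by apply: bnd_unitary; rewrite us.
have v1 : bnd v 1 by apply: bnd_unitary; rewrite vs.
have W1 : bnd W 1.
  have -> : W = half R *: ((- 'i) *: (u - v)).
    rewrite /u /v opprB addrC addrA subrK scalerDr.
    by rewrite /V scalerA mulNr -expr2 sqr_i opprK scale1r half_double.
  have : bnd (u - v) (1 + 1) by apply: bndB.
  move/(bndZ (- 'i)); have -> : nr (- 'i : R[i]^o) = 1.
    rewrite nrN; apply: complexI.
    by rewrite -nrE normc_def /= expr0n expr1n add0r sqrtr1.
  by rewrite mul1r => /bnd_half; rewrite -mulr2n divff // pnatr_eq0.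
split; first by rewrite -WW -[1](mulr1 1); apply: bndM.
have -> : T * T + T * T - 1 = half R *: (u * u + v * v).
  rewrite -[LHS]half_double; congr (_ *: _).
  have VV' : T * T - 1 = V * V by rewrite VV opprB.
  pose c := T * V + V * T.
  have -> : u * u = (T * T + T * T - 1) + c.
    rewrite -[T * T + T * T - 1]addrA VV' /u mulrDl !mulrDr /c !addrA.
    by rewrite [LHS](ACl (1*4*2*3)).
  have -> : v * v = (T * T + T * T - 1) - c.
    rewrite -[T * T + T * T - 1]addrA VV' /v mulrBl !mulrBr /c opprB opprD !addrA.
    by rewrite [LHS](ACl (1*3*2*4)).
  by rewrite [RHS]addrACA subrr addr0.
rewrite [X in bnd _ X](_ : 1 = (1 * 1 + 1 * 1) / 2); last by rewrite !mulr1 -mulr2n divff // pnatr_eq0.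
by apply/bnd_half/bndD; apply: bndM.
Qed.

(** As 1 - T^2 is contractive, |T| exists as the square root of 1 - (1 - T^2). *)
Lemma abs_exists T : ustar T = T -> bnd T 1 ->
  exists N, [/\ bnd (1 - N) 1, ustar N = N, N * N = T * T, N * T = T * N & bnd N 1].
Proof.
move=> Ts T1; have [K1 _] := bnd_sqr1 Ts T1.
have [||N [N1 Ns NN Nc]] := @sqrt_exists (1 - T * T) => //.
  by rewrite ustarB ustar1 ustarM Ts.
exists N; split => //; first by rewrite NN opprB addrC subrK.
  by apply/esym/Nc; rewrite mulrBl mulrBr mul1r mulr1 mulrA.
apply: bnd_star => //; rewrite Ns NN opprB addrC subrK expr1n -[1](mulr1 1).
exact: bndM.
Qed.

End Contractions.

(** * Contractivity of *-actions *)

(** A representation without the continuity of its operators, which is a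
    consequence ([action_bounded], [action_representation]). *)
Record star_action (R : realType) (A : cstarAlgType R) (H : hilbertType R)
    (pi : A -> H -> H) : Prop := StarAction {
  sa_linear : forall a, linear (pi a);
  sa_lin : forall (k : R[i]) a b x, pi (k *: a + b) x = k *: pi a x + pi b x;
  sa_mul : forall a b x, pi (cmul a b) x = pi a (pi b x);
  sa_adj : forall a x y, inner (pi (cadj a) x) y = inner x (pi a y)
}.

Lemma representation_star_action (R : realType) (A : cstarAlgType R)
  (H : hilbertType R) (pi : A -> H -> H) : representation pi -> star_action pi.
Proof. by case. Qed.

Section Actions.
Variables (R : realType) (A : cstarAlgType R) (H : hilbertType R).
Variable pi : A -> H -> H.
Hypothesis hpi : star_action pi.
Local Notation U := (unitz A).
Implicit Types (S T : U) (a b : A) (x y : H).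

Lemma saDr a x y : pi a (x + y) = pi a x + pi a y.
Proof. by have := sa_linear hpi a 1 x y; rewrite !scale1r. Qed.
Lemma sa0r a : pi a 0 = 0.
Proof. by apply: (addIr (pi a 0)); rewrite -saDr !add0r. Qed.
Lemma saZr a k x : pi a (k *: x) = k *: pi a x.
Proof. by have := sa_linear hpi a k x 0; rewrite !addr0 sa0r addr0. Qed.
Lemma saNr a x : pi a (- x) = - pi a x.
Proof. by rewrite -scaleN1r saZr scaleN1r. Qed.
Lemma saBr a x y : pi a (x - y) = pi a x - pi a y.
Proof. by rewrite saDr saNr. Qed.
Lemma saDl a b x : pi (a + b) x = pi a x + pi b x.
Proof. by have := sa_lin hpi 1 a b x; rewrite !scale1r. Qed.
Lemma sa0l x : pi 0 x = 0.
Proof. by apply: (addIr (pi 0 x)); rewrite -saDl !add0r. Qed.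
Lemma saZl k a x : pi (k *: a) x = k *: pi a x.
Proof. by have := sa_lin hpi k a 0 x; rewrite !addr0 sa0l addr0. Qed.
Lemma saNl a x : pi (- a) x = - pi a x.
Proof. by rewrite -scaleN1r saZl scaleN1r. Qed.
Lemma saBl a b x : pi (a - b) x = pi a x - pi b x.
Proof. by rewrite saDl saNl. Qed.

(** The extension of an action to the unitization. *)
Definition urep T x : H := T.1 *: x + pi T.2 x.

Lemma urepM S T x : urep (S * T) x = urep S (urep T x).
Proof.
rewrite /urep /= !saDl !saZl (sa_mul hpi) !saDr saZr scalerDr !scalerA -!addrA.
by congr (_ + (_ + _)).
Qed.
Lemma urepD S T x : urep (S + T) x = urep S x + urep T x.
Proof. by rewrite /urep /= saDl scalerDl addrACA. Qed.
Lemma urepN T x : urep (- T) x = - urep T x.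
Proof. by rewrite /urep /= saNl scaleNr opprD. Qed.
Lemma urepB S T x : urep (S - T) x = urep S x - urep T x.
Proof. by rewrite urepD urepN. Qed.
Lemma urep1 x : urep 1 x = x.
Proof. by rewrite /urep /= sa0l scale1r addr0. Qed.
Lemma urep_emb a x : urep (emb a) x = pi a x.
Proof. by rewrite /urep /= scale0r add0r. Qed.
Lemma urep_adj T x y : inner (urep (ustar T) x) y = inner x (urep T y).
Proof. by rewrite /urep ipDl ipZl ipDr ipZr (sa_adj hpi). Qed.

(** If T^* T is contractive, then 1 - T^* T is the square of a selfadjoint element,
    so |x|^2 - |T x|^2 = <(1 - T^* T) x, x> is nonnegative. *)
Lemma urep_contractive T x : bnd (ustar T * T) 1 -> nr (urep T x) <= nr x.
Proof.
move=> T1; have [||W [_ Ws WW _]] := @sqrt_exists _ _ (ustar T * T) => //.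
  by rewrite ustarM ustarK.
rewrite -(@ler_pXn2r _ 2) ?nnegrE ?nr_ge0 // -subr_ge0 -ler0c rmorphB /= -!ip_nr.
rewrite -urep_adj -urepM -{1}(urep1 x) -ipBl -urepB -WW urepM -{1}Ws urep_adj.
by rewrite ip_nr ler0c exprn_ge0 // nr_ge0.
Qed.

Lemma action_bounded a x : nr (pi a x) <= nr a * nr x.
Proof.
have [->|/eqP /nr_gt0 a0] := eqVneq a 0; first by rewrite sa0l !nr0 mul0r.
have -> : a = (nr a)%:C *: ((nr a)^-1%:C *: a).
  by rewrite scalerA -rmorphM mulfV ?gt_eqF // scale1r.
set b := _^-1%:C *: a; have b1 : nr b = 1.
  by rewrite nrZr ger0_norm ?invr_ge0 ?nr_ge0 // mulVf // gt_eqF.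
rewrite saZl nrZr [nr (_ *: b)]nrZr b1 mulr1 ger0_norm ?nr_ge0 // ler_pM2l //.
rewrite -(urep_emb b) urep_contractive // ustar_emb -embM.
by apply: bnd_emb; rewrite nr_star b1 expr1n.
Qed.
End Actions.

(** * Urysohn pairs *)

Section Urysohn.
Variables (R : realType) (A : cstarAlgType R).
Local Notation U := (unitz A).
Local Notation "a ** b" := (cmul a b) (at level 40, left associativity).

Lemma expr_small (q : R) : 0 <= q -> q < 1 ->
  forall e, 0 < e -> exists N, q ^+ N < e.
Proof.
move=> q0 q1 e e0; have /cvg_expr : `|q| < 1 by rewrite ger0_norm.
move=> /cvgrPdist_lt /(_ e e0) [N _ h]; exists N.
by have := h N (leqnn N); rewrite /= sub0r normrN ger0_norm // exprn_ge0.
Qed.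

Lemma sub1_sqr (S : nzRingType) (x : S) : (1 - x) * (1 - x) = 1 - (x + x - x * x).
Proof. by rewrite mulrBl mul1r mulrBr mulr1 !opprB opprD !addrA [RHS](ACl (1*3*2*4)). Qed.

Lemma comm_sub1 (S : nzRingType) (p x : S) :
  (1 - p) * (1 - x) = (1 - x) * (1 - p) -> p * x = x * p.
Proof.
move=> c; have sub y : y = 1 - (1 - y) by rewrite opprB addrC subrK.
rewrite [p]sub [x]sub; apply: commrB; first exact: commr1.
by apply/commr_sym/commrB; [exact: commr1 | exact/commr_sym].
Qed.

Lemma nr_double (V : normedModType R[i]) (x : V) : nr (x + x) = 2 * nr x.
Proof.
by rewrite -mulr2n -scaler_nat -(rmorph_nat (real_complex R)) nrZr ger0_norm.
Qed.

(** For c = 1 - x the absolute value |c| is 1 - p with p in [A]: the scalar part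
    of |c| is 1 or -1, and it is at distance at most 1 from 1. *)
Lemma abs_at_one (x : A) : cadj x = x -> bnd (1 - emb x) 1 ->
  exists p, [/\ nr p <= 1, cadj p = p, p + p - p ** p = x + x - x ** x,
    p ** x = x ** p & bnd (1 - emb p) 1].
Proof.
move=> xs x1.
have [|N [N1 Ns NN Nx N1']] := abs_exists _ x1.
  by rewrite ustarB ustar1 ustar_emb xs.
have N1E : N.1 = 1.
  have : N.1 ^+ 2 = 1.
    have := congr1 (fun T : U => T.1) NN; rewrite !fstM /= subr0 mulr1 => <-.
    by rewrite expr2.
  move=> /eqP; rewrite sqrf_eq1 => /orP[/eqP //|/eqP N1m].
  case: N1 => + _; rewrite /= N1m opprK -[1 + 1](rmorph_nat (real_complex R) 2).
  by rewrite nr_real ger0_norm // lern1.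
have NE : N = 1 - emb (- N.2).
  by rewrite embN opprK; case: (N) N1E => a b /= ->; congr pair; rewrite ?addr0 ?add0r.
set p := - N.2 in NE; rewrite NE in N1 Ns NN Nx N1'; clearbody p.
exists p; split => //.
- by apply: bnd_emb_nr; rewrite opprB addrC subrK in N1.
- apply: (@emb_inj _ A); move: Ns; rewrite ustarB ustar1 ustar_emb.
  by move=> /addrI /oppr_inj.
- by apply: (@emb_inj _ A); move: NN; rewrite !sub1_sqr !embB !embD !embM => /addrI /oppr_inj.
- by apply: (@emb_inj _ A); rewrite !embM; exact: comm_sub1.
Qed.

Lemma bnd_sqr_cond (x : A) : cadj x = x -> bnd (1 - emb x) 1 ->
  bnd (1 - emb ((x + x - x ** x) + (x + x - x ** x))) 1.
Proof.
move=> xs x1; have [|_] := bnd_sqr1 _ x1; first by rewrite ustarB ustar1 ustar_emb xs.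
rewrite sub1_sqr -embM -embD -embB embD; set y := emb (_ - _).
by rewrite -addrA [1 - y - 1]addrAC subrr add0r -addrA -opprD.
Qed.

Variables (H : hilbertType R) (pi : A -> H -> H).
Hypothesis hpi : star_action pi.

(** With c_0 = 1 - 2 h^2 and c_(j+1) = 2 c_j^2 - 1, this is 1 - c_j. If h = sin t,
    then c_j = cos (2^(j+1) t). *)
Fixpoint doubling (h : A) j : A :=
  if j is j'.+1 then let x := doubling h j' in (x + x - x ** x) + (x + x - x ** x)
  else h ** h + h ** h.

Lemma doubling_adj h j : cadj h = h -> cadj (doubling h j) = doubling h j.
Proof.
move=> hs; elim: j => [|j IH] /=; first by rewrite !cadjD cadjM hs.
by rewrite !cadjD cadjN cadjM IH.
Qed.

Lemma doubling_bnd h j : cadj h = h -> nr h <= 1 -> bnd (1 - emb (doubling h j)) 1.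
Proof.
move=> hs h1; elim: j => [|j IH] /=; last first.
  by apply: bnd_sqr_cond => //; exact: doubling_adj.
have [||_] := @bnd_sqr1 _ _ (emb h); first by rewrite ustar_emb hs.
  exact: bnd_emb.
by move/bndN; rewrite opprB embD embM.
Qed.

Lemma doubling_kill h (T : U) j : T * emb h = 0 -> T * emb (doubling h j) = 0.
Proof.
move=> Th; elim: j => [|j IH] /=; first by rewrite embD embM mulrDr mulrA Th mul0r addr0.
by rewrite !embD !embN !embM !mulrDr !mulrN !mulrA IH !mul0r oppr0 !addr0.
Qed.

Lemma doubling_act0 (K : hilbertType R) (rho : A -> K -> K) h j :
  star_action rho -> (forall x, rho h x = 0) -> forall x, rho (doubling h j) x = 0.
Proof.
move=> hrho h0; elim: j => [|j IH] x /=.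
  by rewrite saDl // (sa_mul hrho) !h0 addr0.
by rewrite !(saDl hrho) (saNl hrho) (sa_mul hrho) !IH oppr0 !addr0.
Qed.

(** An angle which is not a multiple of 2 pi has a negative cosine after enough
    doublings. Here: as x_(j+1) = 4 x_j - 2 x_j^2, if all x_j are bounded by some m <= 1 then 4 |x_j|
    is at most m + 2 m^2 <= 3 m, so that all x_j are bounded by 3 m / 4. Iterating,
    x_0 = 2 h^2 vanishes. *)
Lemma doubling_escape h : cadj h = h -> (exists y, pi h y <> 0) ->
  exists j y, nr y < nr (pi (doubling h j) y).
Proof.
move=> hs [y0 hy0]; apply: contrapT => /forallNP small.
have {}small j y : nr (pi (doubling h j) y) <= nr y.
  by rewrite leNgt; apply/negP => lt; apply: (small j); exists y.
have geo i : forall j y, nr (pi (doubling h j) y) <= (3 / 4) ^+ i * nr y.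
  elim: i => [|i IH] j y; first by rewrite expr0 mul1r.
  set m := _ ^+ i in IH; set x := doubling h j.
  have m0 : 0 <= m by rewrite exprn_ge0 // divr_ge0.
  have m1 : m <= 1 by rewrite exprn_ile1 // ?divr_ge0 // ler_pdivrMr // mul1r ler_nat.
  have e : (pi x y + pi x y) + (pi x y + pi x y) =
      pi (doubling h j.+1) y + (pi x (pi x y) + pi x (pi x y)).
    rewrite /= -/x !(saDl hpi) (saNl hpi) (sa_mul hpi).
    by rewrite [RHS]addrACA !subrK.
  have h1 : 4 * nr (pi x y) <= m * nr y + 2 * (m * (m * nr y)).
    have -> : 4 * nr (pi x y) = nr ((pi x y + pi x y) + (pi x y + pi x y)).
      by rewrite !nr_double; ring.
    rewrite e; apply: le_trans (nrD _ _) _; apply: lerD; first exact: IH.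
    rewrite nr_double ler_pM2l //; apply: le_trans (IH _ _) _.
    by apply: ler_wpM2l => //; exact: IH.
  have : m * (m * nr y) <= m * nr y.
    by apply: ler_wpM2l => //; apply: ler_piMl => //; exact: nr_ge0.
  by rewrite exprSr -/m; lra.
apply: hy0; set z := pi h y0.
have : nr (pi (doubling h 0) y0) <= 0.
  have q1 : 3 / 4 < 1 :> R by lra.
  have q0 : 0 <= 3 / 4 :> R by lra.
  apply: (@le_small R _ 0 (nr y0) _ (nr_ge0 _) (expr_small q0 q1)) => j.
  by rewrite add0r mulrC; exact: geo.
rewrite /= (saDl hpi) nr_double pmulr_rle0 // (sa_mul hpi) -/z => hz.
have hz0 : pi h z = 0 by apply/nr_eq0/eqP; rewrite eq_le hz nr_ge0.
by apply: ip_eq0; rewrite {2}/z -(sa_adj hpi) hs hz0 ip0l.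
Qed.
End Urysohn.

Section UrysohnPair.
Variables (R : realType) (A : cstarAlgType R).
Local Notation U := (unitz A).
Local Notation "a ** b" := (cmul a b) (at level 40, left associativity).

(** The picture: g is supported where b is 1, and b is supported in the support
    of h. Supports are expressed by left annihilators and by the vanishing of
    actions, which make sense without a spectrum. *)
Record urysohn_pair (h b g : A) : Prop := UrysohnPair {
  up_badj : cadj b = b;
  up_gadj : cadj g = g;
  up_bnr : nr b <= 1;
  up_bg : b ** g = g;
  up_kill : forall T : U, T * emb h = 0 -> T * emb b = 0;
  up_act0 : forall (K : hilbertType R) (rho : A -> K -> K), star_action rho ->
    (forall x, rho h x = 0) -> forall x, rho b x = 0
}.

Lemma fixed_double0 (V : normedModType R[i]) (x y : V) :
  nr y <= nr x -> x + x = y -> x = 0.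
Proof.
move=> h e; apply/nr_eq0/eqP; rewrite eq_le nr_ge0 andbT.
by rewrite -e nr_double in h; have := nr_ge0 x; lra.
Qed.

(** If T x = 0, then q = T p satisfies 2 q = q p with p contractive, so q = 0. *)
Lemma kill_abs (T : U) (x p : A) : nr p <= 1 ->
  p + p - p ** p = x + x - x ** x -> T * emb x = 0 -> T * emb p = 0.
Proof.
move=> p1 e Tx; have : T * emb (p + p - p ** p) = 0.
  by rewrite e embB embD embM mulrBr mulrDr mulrA Tx mul0r addr0 subr0.
rewrite embB embD embM mulrBr mulrDr mulrA mul_embE; set q := (_).2.
rewrite -embM -embD -embB => /emb_inj /subr0_eq eq; congr emb.
apply: fixed_double0 eq; apply: le_trans (nrM _ _) _.
by rewrite ler_piMr // nr_ge0.
Qed.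

Lemma act0_abs (K : hilbertType R) (rho : A -> K -> K) (x p : A) :
  star_action rho -> nr p <= 1 -> p + p - p ** p = x + x - x ** x ->
  (forall y, rho x y = 0) -> forall y, rho p y = 0.
Proof.
move=> hr p1 e x0 y; have : rho (p + p - p ** p) y = 0.
  by rewrite e saBl // saDl // (sa_mul hr) !x0 addr0 subr0.
rewrite saBl // saDl // (sa_mul hr) => /subr0_eq.
apply: fixed_double0; apply: le_trans (action_bounded hr _ _) _.
by rewrite ler_piMl // nr_ge0.
Qed.

Lemma cadj_half (a : A) : cadj (half R *: a) = half R *: cadj a.
Proof. by rewrite cadjZ conj_half. Qed.

Variables (H : hilbertType R) (pi : A -> H -> H).
Hypothesis hpi : star_action pi.

(** With c = 1 - x and |c| = 1 - p, take g = (|c| - c)/2 = (x - p)/2, the negative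
    part of c, and b = 1 - n^2, where n = (|c| + c)/2 = 1 - f is its positive part.
    From n g = 0 one gets b g = g, and b is contractive as n is. If g is dead for
    every c_j, then x acts as the contraction p, against [doubling_escape]. *)
Lemma urysohn_contractive h : cadj h = h -> nr h <= 1 -> (exists y, pi h y <> 0) ->
  exists b g, urysohn_pair h b g /\ exists y, pi g y <> 0.
Proof.
move=> hs h1 hl; have [j [y0 hj]] := doubling_escape hpi hs hl.
pose x := doubling h j; have xs : cadj x = x by exact: doubling_adj.
have x1 : bnd (1 - emb x) 1 by exact: doubling_bnd.
have [p [p1 ps pp px p1']] := abs_at_one xs x1.
pose f := half R *: (x + p); pose g := half R *: (x - p).
have fs : cadj f = f by rewrite cadj_half cadjD xs ps.
have gs : cadj g = g by rewrite cadj_half cadjB xs ps.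
have fg : f ** g = g.
  rewrite /f /g cmulZl cmulZr; congr (_ *: _).
  rewrite -[RHS]half_double; congr (_ *: _).
  rewrite cmulDl !cmulBr px addrA subrK [RHS]addrACA -opprD.
  have -> : x ** x = x + x - (p + p - p ** p) by rewrite pp opprB addrC subrK.
  by rewrite opprB addrA addrAC addrK.
have f1 : bnd (1 - emb f) 1.
  have -> : 1 - emb f = half R *: ((1 - emb x) + (1 - emb p)).
    rewrite /f embZ embD addrACA -opprD scalerBr; congr (_ - _).
    by rewrite half_double.
  rewrite [X in bnd _ X](_ : 1 = (1 + 1) / 2); first exact/bnd_half/bndD.
  by rewrite -mulr2n divff // pnatr_eq0.
pose b := f + f - f ** f.
have bs : cadj b = b by rewrite cadjB cadjD cadjM fs.
exists b, g; split; last first.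
  apply: contrapT => /forallNP g0.
  have xp y : pi x y = pi p y.
    apply: subr0_eq; rewrite -saBl // -[x - p]half_double scalerDr -/g saDl //.
    by have /contrapT := g0 y => ->; rewrite addr0.
  move: hj; rewrite -/x xp ltNge => /negP; apply.
  apply: le_trans (action_bounded hpi _ _) _.
  by rewrite ler_piMl // nr_ge0.
split => //.
- have [|+ _] := bnd_sqr1 _ f1; first by rewrite ustarB ustar1 ustar_emb fs.
  rewrite sub1_sqr opprB addrC subrK -embM -embD -embB.
  exact: bnd_emb_nr.
- by rewrite /b cmulBl cmulDl -cmulA !fg addrK.
- move=> T Th; have Tx : T * emb x = 0 by exact: doubling_kill.
  have Tp := kill_abs p1 pp Tx.
  have Tf : T * emb f = 0.
    by rewrite /f embZ -scalerAr embD mulrDr Tx Tp addr0 scaler0.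
  by rewrite /b embB embD embM mulrBr mulrDr mulrA Tf mul0r addr0 subr0.
- move=> K rho hr h0; have x0 := doubling_act0 j hr h0; rewrite -/x in x0.
  have p0 := act0_abs hr p1 pp x0.
  have f0 y : rho f y = 0 by rewrite /f saZl // saDl // x0 p0 addr0 scaler0.
  by move=> y; rewrite /b saBl // saDl // (sa_mul hr) !f0 addr0 subr0.
Qed.

Lemma urysohn_exists h : cadj h = h -> (exists y, pi h y <> 0) ->
  exists b g, urysohn_pair h b g /\ exists y, pi g y <> 0.
Proof.
move=> hs hl.
have h0 : 0 < nr h.
  by apply: nr_gt0 => h0; case: hl => y; rewrite h0 sa0l.
pose k : R[i] := ((nr h)^-1)%:C.
have k0 : k != 0.
  by rewrite /k -[0](rmorph0 (real_complex R)) (inj_eq (@complexI _)) invr_eq0 gt_eqF.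
have [| | |b [g [up gl]]] := @urysohn_contractive (k *: h).
- by rewrite cadjZ hs; congr (_ *: _); apply/CrealP; rewrite realE lecR invr_ge0 ltW.
- by rewrite nrZr ger0_norm ?invr_ge0 ?nr_ge0 // mulVf // gt_eqF.
- case: hl => y hy; exists y; rewrite saZl // => /eqP.
  by rewrite scaler_eq0 (negbTE k0) => /eqP.
exists b, g; split => //; case: up => bs gs b1 bg kill act0.
split => // [T Th|K rho hr r0].
  by apply: kill; rewrite embZ -scalerAr Th scaler0.
by apply: act0 => // x; rewrite saZl // r0 scaler0.
Qed.

End UrysohnPair.


(** * Positive and negative parts *)

Section Parts.
Variables (R : realType) (A : cstarAlgType R).
Local Notation U := (unitz A).
Local Notation "a ** b" := (cmul a b) (at level 40, left associativity).

Lemma nr_star0 (a : A) : cadj a ** a = 0 -> a = 0.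
Proof.
by move=> e; apply: nr_eq0; apply/eqP; rewrite -sqrf_eq0 -nr_star e nr0.
Qed.

(** The parts are (|h| + h)/2 and (|h| - h)/2. The absolute value is in turn the
    square of a selfadjoint element, and therefore positive in every action. *)
Lemma posneg_exists (h : A) : cadj h = h -> nr h <= 1 ->
  exists p m, [/\ cadj p = p, cadj m = m, p ** m = 0,
    forall T : U, T * emb h = 0 -> T * emb p = 0 /\ T * emb m = 0 &
    forall (K : hilbertType R) (rho : A -> K -> K), star_action rho ->
      ((forall x, rho p x = 0) -> forall x, inner (rho h x) x <= 0) /\
      ((forall x, rho m x = 0) -> forall x, 0 <= inner (rho h x) x)].
Proof.
move=> hs h1.
have [||N [N1 Ns NN Nh N1']] := @abs_exists _ _ (emb h).
- by rewrite ustar_emb hs.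
- exact: bnd_emb.
have NE : N = emb N.2.
  apply: embE; apply/eqP; rewrite -sqrf_eq0 expr2.
  by have := congr1 (fun T : U => T.1) NN; rewrite !fstM /= mulr0 => ->.
have [||W [_ Ws WW _]] := @sqrt_exists _ _ (1 - N) => //.
  by rewrite ustarB ustar1 Ns.
rewrite opprB addrC subrK in WW.
set n := N.2 in NE; clearbody n; rewrite NE in Ns NN Nh WW => {N NE N1 N1'}.
rewrite ustar_emb in Ns; rewrite -!embM in NN Nh.
move/emb_inj in Ns; move/emb_inj in NN; move/emb_inj in Nh.
exists (half R *: (n + h)), (half R *: (n - h)); split.
- by rewrite cadj_half cadjD Ns hs.
- by rewrite cadj_half cadjB Ns hs.
- by rewrite cmulZl cmulZr cmulDl !cmulBr Nh NN addrA subrK subrr !scaler0.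
- move=> T Th; have Tn : T * emb n = 0.
    rewrite mul_embE; set q := (_).2; rewrite -emb0; congr emb.
    rewrite -[q]cadjK; have /nr_star0 -> : cadj (cadj q) ** cadj q = 0; last by rewrite cadj0.
    apply: (@emb_inj _ A); rewrite cadjK embM -ustar_emb -mul_embE ustarM mulrA.
    by rewrite ustar_emb Ns -[T * _ * _]mulrA -embM NN embM mulrA Th !mul0r.
  by rewrite !embZ -!scalerAr embD embB mulrDr mulrBr Tn Th addr0 subr0 scaler0.
- move=> K rho hr; have npos x : 0 <= inner (rho n x) x.
    rewrite -(urep_emb rho n) -WW (urepM hr) -{1}Ws (urep_adj hr); exact: ip_ge0.
  have dead (y z : A) x : (forall x, rho (half R *: (y + z)) x = 0) -> rho z x = - rho y x.
    move=> /(_ x) e; have : rho (half R *: ((y + z) + (y + z))) x = 0.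
      by rewrite scalerDr saDl // e addr0.
    by rewrite half_double saDl // addrC => /eqP; rewrite addr_eq0 => /eqP.
  split => dx x; first by rewrite (dead _ _ _ dx) -scaleN1r ipZl mulN1r oppr_le0.
  have := dead _ _ x dx; rewrite saNl // => /oppr_inj ->; exact: npos.
Qed.
End Parts.

(** * Irreducible actions *)

Section Irreducible.
Variables (R : realType) (A : cstarAlgType R) (H : hilbertType R).
Variable s : A -> H -> H.
Hypotheses (hs : star_action s) (irr : irreducible s).
Local Notation U := (unitz A).
Local Notation "a ** b" := (cmul a b) (at level 40, left associativity).

Definition live (a : A) : Prop := exists x, s a x <> 0.

Lemma notlive a : ~ live a -> forall x, s a x = 0.
Proof. by move=> /forallNP h x; have /contrapT := h x. Qed.

(** The vectors orthogonal to the orbit of x form a closed invariant subspace. If it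
    were everything, then x would be a common null vector, and these form a closed
    invariant subspace too. *)
Lemma cyclic_orth x y : x <> 0 -> (forall a, inner (s a x) y = 0) -> y = 0.
Proof.
move=> x0 xy; case: irr => -[a0 [x1 live1]] irrV.
have [] := irrV [set z | forall a, inner (s a x) z = 0].
- split => [a|k u v hu hv a|]; first by rewrite ip0r.
    by rewrite ipDr ipZr hu hv mulr0 addr0.
  apply: closed_approx => z hz a; apply: (@nr_eq0 _ (R[i]^o)); apply/eqP.
  rewrite eq_le nr_ge0 andbT; apply/ler_addgt0Pr => e e0.
  have c0 : 0 < nr (s a x) + 1 by rewrite ltr_wpDl ?nr_ge0.
  have [u [hu zu]] := hz (e / (nr (s a x) + 1)) (divr_gt0 e0 c0).
  have -> : inner (s a x) z = inner (s a x) (z - u) by rewrite ipBr hu subr0.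
  rewrite add0r; apply: le_trans (nr_inner _ _) _.
  rewrite -(divfK (lt0r_neq0 c0) e) [X in _ <= X]mulrC.
  by apply: ler_pM; rewrite ?nr_ge0 ?lerDl // ltW.
- by move=> b u hu a; rewrite -(sa_adj hs) -(sa_mul hs).
- by move=> /seteqP[/(_ y xy)].
move=> /seteqP[_ all0]; have ax a : s a x = 0 by apply: ip_eq0; apply: all0.
have [] := irrV [set z | forall a, s a z = 0].
- split => [a|k u v hu hv a|]; first exact: sa0r.
    by rewrite saDr // saZr // hu hv scaler0 addr0.
  apply: closed_approx => z hz a; apply: nr_eq0; apply/eqP.
  rewrite eq_le nr_ge0 andbT; apply/ler_addgt0Pr => e e0.
  have c0 : 0 < nr a + 1 by rewrite ltr_wpDl ?nr_ge0.
  have [u [hu zu]] := hz (e / (nr a + 1)) (divr_gt0 e0 c0).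
  have -> : s a z = s a (z - u) by rewrite saBr // hu subr0.
  rewrite add0r; apply: le_trans (action_bounded hs _ _) _.
  rewrite -(divfK (lt0r_neq0 c0) e) [X in _ <= X]mulrC.
  by apply: ler_pM; rewrite ?nr_ge0 ?lerDl // ltW.
- by move=> b u hu a; rewrite -(sa_mul hs).
- by move=> /seteqP[/(_ x ax)].
by move=> /seteqP[_ /(_ x1 I a0)].
Qed.

Lemma live_adj a : live a -> live (cadj a).
Proof.
move=> [x ax]; apply: contrapT => /notlive d; apply: ax; apply: ip_eq0.
by rewrite -(sa_adj hs) d ip0l.
Qed.

(** The kernel of an irreducible action is a prime ideal. *)
Lemma live_prime a b : live a -> live b -> exists y, live (a ** y ** b).
Proof.
move=> la [x bx]; apply: contrapT => /forallNP h.
have [z] := live_adj la; apply; apply: (cyclic_orth bx) => y.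
by rewrite -(sa_adj hs) cadjK -!(sa_mul hs) (notlive (h y)) ip0l.
Qed.

Lemma live_star a : live a -> live (a ** cadj a).
Proof.
move=> /live_adj [x ax]; exists x => e; apply: ax; apply: ip_eq0.
by rewrite (sa_adj hs) -(sa_mul hs) e ip0r.
Qed.
End Irreducible.

(** * Splitting an element of rank at least two *)

Section Splitting.
Variables (R : realType) (A : cstarAlgType R) (H : hilbertType R).
Variable s : A -> H -> H.
Hypotheses (hs : star_action s) (irr : irreducible s).
Local Notation U := (unitz A).
Local Notation "a ** b" := (cmul a b) (at level 40, left associativity).
Local Notation live := (live s).

Lemma Re_le0 (z : R[i]) : z <= 0 -> complex.Re z <= 0.
Proof. by rewrite lecE => /andP[]. Qed.
Lemma Re_ge0 (z : R[i]) : 0 <= z -> 0 <= complex.Re z.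
Proof. by rewrite lecE => /andP[]. Qed.
Lemma ReD (z w : R[i]) : complex.Re (z + w) = complex.Re z + complex.Re w.
Proof. by case: z; case: w. Qed.
Lemma ReN (z : R[i]) : complex.Re (- z) = - complex.Re z.
Proof. by case: z. Qed.
Lemma Re_conj (z : R[i]) : complex.Re (Num.conj z) = complex.Re z.
Proof. by case: z. Qed.

(** If there is no splitting, then for all selfadjoint a and real t, the operator
    of b' a b' - t b'^2 is nonpositive or nonnegative. On the range of b this
    operator is a - t as a quadratic form, so the numerical values of a at two
    vectors of equal norm in the range of b cannot be separated by any t and agree.
    Let e1 and e2 be the images of x1 and x2 under b. Comparing e1 + w and e1 - w
    for w = e2 and w = i e2 shows that a e1 is orthogonal to e2 for all a, which
    contradicts irreducibility. *)
Lemma split_support (b' b : A) (x1 x2 : H) :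
  cadj b' = b' -> b' ** b = b ->
  s b x1 <> 0 -> s b x2 <> 0 -> inner (s b x1) (s b x2) = 0 ->
  exists p m, [/\ cadj p = p, cadj m = m, p ** m = 0, live p /\ live m &
    forall T : U, T * emb b' = 0 -> T * emb p = 0 /\ T * emb m = 0].
Proof.
move=> b's b'b e10 e20 e12; apply: contrapT => nosplit.
pose h a (t : R) := b' ** a ** b' - t%:C *: (b' ** b').
have semidef a t : cadj a = a -> (forall x, inner (s (h a t) x) x <= 0) \/
    (forall x, 0 <= inner (s (h a t) x) x).
  move=> sa; set g := h a t.
  have gs : cadj g = g.
    rewrite /g /h cadjB cadjZ !cadjM b's sa cmulA; congr (_ - _ *: _).
    by apply/CrealP; rewrite complex_real.
  (* A positive factor makes g contractive; the 1 covers g = 0. *)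
  pose k := (nr g + 1)^-1; have k0 : 0 < k by rewrite invr_gt0 ltr_wpDl ?nr_ge0.
  have kC : 0 < k%:C :> R[i] by rewrite ltcR.
  have [||p [m [ps ms pm kill pos]]] := @posneg_exists _ _ (k%:C *: g).
  - by rewrite cadjZ gs; congr (_ *: _); apply/CrealP; rewrite gtr0_real.
  - rewrite nrZr gtr0_norm // mulrC ler_pdivrMr ?mul1r ?lerDl //.
    by rewrite ltr_wpDl ?nr_ge0.
  have [pos1 pos2] := pos _ _ hs.
  have [lp|/notlive dp] := pselect (live p); last first.
    by left=> x; have := pos1 dp x; rewrite saZl // ipZl pmulr_rle0.
  have [lm|/notlive dm] := pselect (live m); last first.
    by right=> x; have := pos2 dm x; rewrite saZl // ipZl pmulr_rge0.
  exfalso; apply: nosplit; exists p, m; split => // T Tb.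
  apply: kill; rewrite embZ -scalerAr /g /h embB embZ !embM mulrBr -scalerAr !mulrA.
  by rewrite Tb !mul0r scaler0 subr0 scaler0.
pose F u := s b' u = u.
have hF a t u : F u -> inner (s (h a t) u) u = inner (s a u) u - (t * nr u ^+ 2)%:C.
  move=> Fu; rewrite saBl // saZl // !(sa_mul hs) Fu Fu ipBl ipZl ip_nr.
  by rewrite -{1}b's (sa_adj hs) Fu [in RHS]rmorphM.
pose q a u := complex.Re (inner (s a u) u).
have qle a u v : cadj a = a -> F u -> F v -> nr u = nr v -> q a v <= q a u.
  move=> sa Fu Fv uv; rewrite leNgt; apply/negP => lt.
  have n0 : nr u ^+ 2 != 0.
    rewrite sqrf_eq0; apply/eqP => u0; move: lt; rewrite /q.
    by rewrite (nr_eq0 u0) (@nr_eq0 _ _ v) ?ltxx // -uv.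
  have tE : ((q a u + q a v) / 2 / nr u ^+ 2) * nr u ^+ 2 = (q a u + q a v) / 2.
    by rewrite divfK.
  case: (semidef a ((q a u + q a v) / 2 / nr u ^+ 2) sa) => [/(_ v)|/(_ u)].
    by rewrite hF // -uv tE => /Re_le0; rewrite ReD ReN -/(q a v) /=; lra.
  by rewrite hF // tE => /Re_ge0; rewrite ReD ReN -/(q a u) /=; lra.
have Fb x : F (s b x) by rewrite /F -(sa_mul hs) b'b.
set e1 := s b x1 in e10 e12; set e2 := s b x2 in e20 e12.
have Re0 a w : cadj a = a -> F w -> inner e1 w = 0 -> complex.Re (inner (s a e1) w) = 0.
  move=> sa Fw e1w; have Fe : F e1 := Fb x1.
  have Fp : F (e1 + w) by rewrite /F saDr // Fe Fw.
  have Fm : F (e1 - w) by rewrite /F saBr // Fe Fw.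
  have : q a (e1 + w) = q a (e1 - w).
    by apply/eqP; rewrite eq_le !qle // (nr_orth e1w).
  rewrite /q saBr // saDr // !(ipBl, ipBr, ipDl, ipDr).
  have -> : inner (s a w) e1 = Num.conj (inner (s a e1) w).
    by rewrite -{1}sa (sa_adj hs) ipC.
  by rewrite !(ReD, ReN) Re_conj; lra.
have orth a : cadj a = a -> inner (s a e1) e2 = 0.
  move=> sa; apply/eqP; rewrite eq_complex; apply/andP; split; apply/eqP.
    by apply: Re0 => //; exact: Fb.
  have := Re0 a ('i *: e2) sa; rewrite !ipZr e12 mulr0 conj_i => /(_ _ erefl).
  have -> : complex.Re (- 'i * inner (s a e1) e2) = complex.Im (inner (s a e1) e2).
    by case: (inner _ _) => u v /=; rewrite oppr0 mul0r sub0r mulN1r opprK.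
  by apply; rewrite /F saZr // Fb.
apply: e20; apply: (cyclic_orth hs irr e10) => a.
have h1 : inner (s a e1) e2 + inner (s (cadj a) e1) e2 = 0.
  by rewrite -ipDl -saDl //; apply: orth; rewrite cadjD cadjK addrC.
have h2 : 'i * (inner (s a e1) e2 - inner (s (cadj a) e1) e2) = 0.
  rewrite -ipBl -saBl // -ipZl -saZl //; apply: orth.
  by rewrite cadjZ cadjB cadjK conj_i scaleNr -scalerN opprB.
have i0 : 'i != 0 :> R[i] by rewrite eq_complex /= oner_eq0 andbF.
move/eqP: h2; rewrite mulf_eq0 (negbTE i0) /= subr_eq0 => /eqP h2.
move/eqP: h1; rewrite -h2 -mulr2n mulrn_eq0 /= => /eqP //.
Qed.

End Splitting.

(** * Orthogonal families of arbitrary size *)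

Section OrthogonalFamilies.
Variables (R : realType) (A : cstarAlgType R) (H : hilbertType R).
Variable s : A -> H -> H.
Hypotheses (hs : star_action s) (irr : irreducible s).
Local Notation U := (unitz A).
Local Notation "a ** b" := (cmul a b) (at level 40, left associativity).
Local Notation live := (live s).

(** The support of [c] is contained in that of [g]. *)
Definition below (c g : A) : Prop := forall T : U, T * emb g = 0 -> T * emb c = 0.

Definition orthogonal_family n (g : nat -> A) : Prop :=
  (forall i, (i < n)%N -> cadj (g i) = g i /\ live (g i)) /\
  (forall i j, (i < n)%N -> (j < n)%N -> i != j -> g i ** g j = 0).

Lemma sym_orth (x y : A) : cadj x = x -> cadj y = y -> x ** y = 0 -> y ** x = 0.
Proof. by move=> xs ys xy; rewrite -xs -{1}ys -cadjM xy cadj0. Qed.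

Lemma emb_mul0 (x y : A) : emb x * emb y = 0 <-> x ** y = 0.
Proof. by split => [|e]; rewrite -embM -?emb0 ?e // => /emb_inj. Qed.

Lemma below_mul (x c g : A) : below c g -> x ** g = 0 -> x ** c = 0.
Proof. by move=> cg /emb_mul0 xg; apply/emb_mul0/cg. Qed.

Lemma below_orth (c g c' g' : A) : below c g -> below c' g' ->
  cadj c = c -> cadj g' = g' -> g' ** g = 0 -> c ** c' = 0.
Proof.
move=> cg c'g' cs g's gg; apply: (below_mul c'g'); apply: sym_orth => //.
exact: below_mul gg.
Qed.

(** Two nested Urysohn pairs inside the support of g: b' is 1 on b, b is 1 on c. *)
Definition nested (g b' b c : A) : Prop :=
  [/\ cadj b' = b', cadj b = b, cadj c = c & b' ** b = b /\ b ** c = c] /\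
  [/\ live c, below b' g, below b g & below c g].

Lemma nested_below (g : A) : cadj g = g -> live g ->
  exists t : A * A * A, nested g t.1.1 t.1.2 t.2.
Proof.
move=> gs gl; have [b' [g' [[b's g's _ bg' kill _] gl']]] := urysohn_exists hs gs gl.
have [b [c [[bs cs _ bc kill' _] lc]]] := urysohn_exists hs g's gl'.
have b'b : b' ** b = b.
  apply: (@emb_inj _ A); apply/eqP; rewrite embM eq_sym -subr_eq0 -[X in X - _]mul1r -mulrBl.
  by apply/eqP/kill'; rewrite mulrBl mul1r -embM bg' subrr.
have bb T : T * emb g = 0 -> T * emb b = 0.
  by move=> /kill Tb; rewrite -b'b embM mulrA Tb mul0r.
exists (b', b, c); split; split => //.
by move=> T /bb Tb; rewrite -bc embM mulrA Tb mul0r.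
Qed.

Lemma extend_split n g i p m : orthogonal_family n g -> (i < n)%N ->
  cadj p = p -> cadj m = m -> p ** m = 0 -> live p -> live m ->
  below p (g i) -> below m (g i) -> exists f, orthogonal_family n.+1 f.
Proof.
move=> [g1 g2] i_n ps ms pm lp lm pg mg.
have mp := sym_orth ps ms pm; have self x : below x x by [].
have og x j : below x (g i) -> cadj x = x -> (j < n)%N -> j != i -> x ** g j = 0.
  move=> xg xs j_n ji; have [gs _] := g1 j j_n.
  by apply: below_orth xg (self _) xs gs _; exact: g2.
have go x j : below x (g i) -> cadj x = x -> (j < n)%N -> j != i -> g j ** x = 0.
  by move=> xg xs j_n ji; have [gs _] := g1 j j_n; apply: sym_orth => //; exact: og.
have ltn' j : j != n -> (j < n.+1)%N -> (j < n)%N by rewrite ltnS leq_eqVlt => /negbTE ->.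
exists (fun j => if j == i then p else if j == n then m else g j); split.
  move=> j jn; case: eqP => [//|_]; case: eqP => [//|/eqP jn'].
  by apply: g1; exact: ltn'.
move=> j k jn kn jk.
case: (eqVneq j i) => [ji|ji]; case: (eqVneq k i) => [ki|ki].
- by rewrite ji ki eqxx in jk.
- by case: (eqVneq k n) => [//|k_n]; apply: og => //; exact: ltn'.
- by case: (eqVneq j n) => [//|j_n]; apply: go => //; exact: ltn'.
case: (eqVneq j n) => [ej|j_n]; case: (eqVneq k n) => [ek|k_n].
- by rewrite ej ek eqxx in jk.
- by apply: og => //; exact: ltn'.
- by apply: go => //; exact: ltn'.
- by apply: g2 => //; exact: ltn'.
Qed.

Lemma rank_le1 (b : A) :
  (forall x1 x2, s b x1 <> 0 -> s b x2 <> 0 -> inner (s b x1) (s b x2) <> 0) ->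
  exists e : H, forall x, exists c : R[i], s b x = c *: e.
Proof.
move=> h; have [[x1 hx1]|h0] := pselect (exists x1, s b x1 <> 0); last first.
  by exists 0 => x; exists 0; rewrite scaler0; apply: contrapT => hx; apply: h0; exists x.
exists (s b x1) => x; set u := s b x1 in hx1 *.
exists (inner (s b x) u / inner u u); apply: subr0_eq; apply: contrapT => hw.
pose y := x - (inner (s b x) u / inner u u) *: x1.
have ye : s b y = s b x - (inner (s b x) u / inner u u) *: u by rewrite saBr // saZr.
apply: (h y x1) => //; first by rewrite ye.
rewrite ye ipBl ipZl divfK ?subrr //; apply/eqP => /ip_eq0; exact: hx1.
Qed.

(** Nest b'_i, b_i, c_i inside each g_i and let e = 1 - sum b_i, which annihilates
    all c_i. If some z = e y e is live, then z z^* can be joined to the c_i. If not,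
    e acts as 0 by irreducibility and every vector is the sum of its images under
    the b_i; in infinite dimension some b_i has rank at least 2, and g_i can be
    replaced by two orthogonal elements. *)
Lemma orthogonal_family_exists : ~ finite_dim H ->
  forall n, exists g, orthogonal_family n g.
Proof.
move=> infH; elim => [|n [g gO]]; first by exists (fun _ => 0).
have [g1 g2] := gO.
have [i|t ht] := @choice nat (A * A * A)%type
    (fun i t => (i < n)%N -> nested (g i) t.1.1 t.1.2 t.2).
  case: (ltnP i n) => [i_n|_]; last by exists (0, 0, 0).
  by have [gs gl] := g1 i i_n; have [t ht] := nested_below gs gl; exists t.
pose b i := (t i).1.2; pose c i := (t i).2; pose b' i := (t i).1.1.
have {}ht i : (i < n)%N -> nested (g i) (b' i) (b i) (c i) := ht i.
pose e : U := 1 - \sum_(i < n) emb (b i).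
have es : ustar e = e.
  rewrite /e ustarB ustar1; congr (_ - _).
  rewrite (big_morph _ (@ustarD _ _) (_ : ustar 0 = 0)); last by rewrite -emb0 ustar_emb cadj0.
  by apply: eq_bigr => i _; rewrite ustar_emb; have [[_ -> _ _] _] := ht i (ltn_ord i).
have ec j : (j < n)%N -> e * emb (c j) = 0.
  move=> jn; have [[_ _ cs [_ bc]] [_ _ _ cg]] := ht j jn.
  rewrite /e mulrBl mul1r mulr_suml (bigD1 (Ordinal jn)) //= big1 => [|i ij].
    by rewrite addr0 -embM bc subrr.
  have [[_ bs _ _] [_ _ bg _]] := ht i (ltn_ord i); have [gs _] := g1 j jn.
  apply/emb_mul0/(below_orth bg cg) => //; apply: g2 => //; rewrite eq_sym.
  by apply: contra ij => /eqP ij; apply/eqP/val_inj.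
have [[y yl]|noy] := pselect (exists y, live (e * emb y * e).2).
  set z := (_).2 in yl; have zE : e * emb y * e = emb z.
    by apply: embE; rewrite fstM mul_emb1 mul0r.
  pose d := z ** cadj z; have ds : cadj d = d by rewrite cadjM cadjK.
  have dl : live d by exact: live_star.
  have dc j : (j < n)%N -> d ** c j = 0.
    move=> jn; apply/emb_mul0; rewrite embM -ustar_emb -zE !ustarM es -!mulrA.
    by rewrite ec // !mulr0.
  exists (fun j => if j == n then d else c j).
  have ltn' j : j != n -> (j < n.+1)%N -> (j < n)%N by rewrite ltnS leq_eqVlt => /negbTE ->.
  split => [j jn|j k jn kn jk].
    by case: (eqVneq j n) => [//|j_n]; have [[_ _ ? _] [? _ _ _]] := ht j (ltn' j j_n jn).
  have cs i : (i < n)%N -> cadj (c i) = c i by move=> /ht [[]].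
  case: (eqVneq j n) => [ej|j_n]; case: (eqVneq k n) => [ek|k_n].
  - by rewrite ej ek eqxx in jk.
  - by apply/dc/ltn'.
  - exact: sym_orth ds (cs _ (ltn' _ j_n jn)) (dc _ (ltn' _ j_n jn)).
  - have [[_ _ cjs _] [_ _ _ cj]] := ht j (ltn' j j_n jn).
    have [[_ _ _ _] [_ _ _ ck]] := ht k (ltn' k k_n kn).
    have [gs _] := g1 k (ltn' k k_n kn).
    by apply: (below_orth cj ck) => //; apply: g2; rewrite ?ltn' // eq_sym.
have e0 x : urep s e x = 0.
  apply: contrapT => ex; apply: (ex); apply: (cyclic_orth hs irr ex) => y.
  have -> : inner (s y (urep s e x)) (urep s e x) = inner (urep s (e * emb y * e) x) x.
    by rewrite !urepM // urep_emb -(urep_adj hs e) es.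
  have zE : e * emb y * e = emb (e * emb y * e).2.
    by apply: embE; rewrite fstM mul_emb1 mul0r.
  have nl : ~ live (e * emb y * e).2 by move=> l; apply: noy; exists y.
  by rewrite zE urep_emb (notlive nl) ip0l.
have sumb x : x = \sum_(i < n) s (b i) x.
  have : urep s e x = 0 := e0 x.
  rewrite /e urepB // urep1 // => /subr0_eq {1}->.
  rewrite (big_morph (fun T => urep s T x) (fun S T => urepD hs S T x) (_ : urep s 0 x = 0)).
    by apply: eq_bigr => i _; rewrite urep_emb.
  by rewrite -emb0 urep_emb // sa0l.
have [i [i_n [x1 [x2 [h1 h2 h12]]]]] : exists i, (i < n)%N /\ exists x1 x2,
    [/\ s (b i) x1 <> 0, s (b i) x2 <> 0 & inner (s (b i) x1) (s (b i) x2) = 0].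
  apply: contrapT => no; apply: infH; exists n.
  have line (i : 'I_n) : exists v : H, forall x, exists k : R[i], s (b i) x = k *: v.
    apply: rank_le1 => x1 x2 h1 h2 h12; apply: no; exists i; split => //.
    by exists x1, x2.
  have [v hv] := choice line; exists v => x.
  have [k hk] := choice (fun i => hv i x); exists k.
  by rewrite [LHS]sumb; apply: eq_bigr.
have [[b's bs _ [b'b _]] [_ b'g _ _]] := ht i i_n.
have [p [m [ps ms pm [lp lm] kill]]] := split_support hs irr b's b'b h1 h2 h12.
apply: (extend_split gO i_n ps ms pm lp lm) => T /b'g /kill [] //.
Qed.

End OrthogonalFamilies.

(** * The Hilbert space of column vectors *)

(** A copy of the type of column vectors, to carry the Euclidean norm. *)
Definition l2 (R : realType) (n : nat) : Type := 'cV[R[i]]_n.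

Section L2.
Variables (R : realType) (n : nat).
Local Notation C := R[i].
Local Notation V := (l2 R n).
HB.instance Definition _ := Vector.copy V 'cV[R[i]]_n.

Definition l2dot (u v : V) : C := \sum_(i < n) u i 0 * Num.conj (v i 0).

Fact l2dot_bilinear : bilinear_for
  (GRing.Scale.Law.clone _ _ *%R _) (GRing.Scale.Law.clone _ _ (Num.conj \; *%R) _) l2dot.
Proof.
split => [u' k u v|u k v w]; rewrite /l2dot /=.
  rewrite mulr_sumr -big_split; apply: eq_bigr => i _ /=.
  by rewrite !mxE mulrDl mulrA.
rewrite mulr_sumr -big_split; apply: eq_bigr => i _ /=.
by rewrite !mxE rmorphD rmorphM mulrDr mulrCA.
Qed.
HB.instance Definition _ := bilinear_isBilinear.Build C V V C _ _ l2dot l2dot_bilinear.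

Fact l2dot_herm (u v : V) : l2dot u v = (-1) ^+ false * Num.conj (l2dot v u).
Proof.
rewrite expr0 mul1r rmorph_sum; apply: eq_bigr => i _ /=.
by rewrite rmorphM /= conjCK mulrC.
Qed.
HB.instance Definition _ := isHermitianSesquilinear.Build C V false Num.conj l2dot l2dot_herm.

Lemma l2dot_norm (u : V) : l2dot u u = (l2norm u ^+ 2)%:C.
Proof.
rewrite /l2norm sqr_sqrtr; last by apply: sumr_ge0 => i _; rewrite addr_ge0 ?sqr_ge0.
by rewrite rmorph_sum; apply: eq_bigr => i _ /=; rewrite add_Re2_Im2 normCK.
Qed.

Lemma l2norm_eq0 (u : V) : l2norm u = 0 -> u = 0.
Proof.
move=> /eqP; rewrite sqrtr_eq0 => h.
have pos (i : 'I_n) : true -> 0 <= complex.Re (u i 0) ^+ 2 + complex.Im (u i 0) ^+ 2.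
  by rewrite addr_ge0 ?sqr_ge0.
have s0 : \sum_(i < n) (complex.Re (u i 0) ^+ 2 + complex.Im (u i 0) ^+ 2) = 0.
  by apply/eqP; rewrite eq_le h sumr_ge0.
apply/matrixP => i j; rewrite (ord1 j) mxE; apply/eqP; rewrite eq_complex /=.
have /eqP := psumr_eq0P pos s0 (erefl true : (fun=> true) i).
by rewrite paddr_eq0 ?sqr_ge0 // !sqrf_eq0.
Qed.

Fact l2dot_pos (u : V) : u != 0 -> 0 < l2dot u u.
Proof.
move=> u0; rewrite l2dot_norm ltcR exprn_gt0 // lt_neqAle sqrtr_ge0 andbT eq_sym.
by apply: contra u0 => /eqP /l2norm_eq0 ->.
Qed.
HB.instance Definition _ := isDotProduct.Build C V l2dot l2dot_pos.

Fact sqrtC_l2dot (u : V) : sqrtC (l2dot u u) = (l2norm u)%:C.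
Proof. by rewrite l2dot_norm rmorphXn /= sqrCK // ler0c sqrtr_ge0. Qed.

Fact l2_normD (u v : V) : (l2norm (u + v))%:C <= (l2norm u)%:C + (l2norm v)%:C.
Proof. by rewrite -!sqrtC_l2dot (triangle_lerif (l2dot : {dot V for Num.conj})). Qed.

Fact l2_normZ (k : C) (u : V) : (l2norm (k *: u))%:C = `|k| * (l2norm u)%:C.
Proof.
have pos w : 0 <= (l2norm w)%:C :> C by rewrite ler0c sqrtr_ge0.
have sq w : (l2norm w)%:C ^+ 2 = l2dot w w by rewrite l2dot_norm rmorphXn.
apply/eqP; rewrite -(@eqrXn2 _ 2) ?(mulr_ge0 (normr_ge0 _)) //.
rewrite exprMn !sq normCK.
by rewrite [l2dot (_ *: _) _]linearZl_LR linearZr_LR /= mulrA.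
Qed.

Fact l2_norm0 (u : V) : (l2norm u)%:C = 0 -> u = 0.
Proof. by move=> /(@complexI _ _ 0); exact: l2norm_eq0. Qed.

HB.instance Definition _ := Lmodule_isNormed.Build C V l2_normD l2_normZ l2_norm0.

Lemma l2_nr (u : V) : nr u = l2norm u.
Proof. by []. Qed.

Lemma l2norm_ge_Re (u : V) i : `|complex.Re (u i 0)| <= nr u.
Proof.
rewrite l2_nr -sqrtr_sqr ler_wsqrtr // (bigD1 i) //= -addrA lerDl.
by rewrite addr_ge0 ?sqr_ge0 // sumr_ge0 // => j _; rewrite addr_ge0 ?sqr_ge0.
Qed.
Lemma l2norm_ge_Im (u : V) i : `|complex.Im (u i 0)| <= nr u.
Proof.
rewrite l2_nr -sqrtr_sqr ler_wsqrtr // (bigD1 i) //= addrAC lerDr.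
by rewrite addr_ge0 ?sqr_ge0 // sumr_ge0 // => j _; rewrite addr_ge0 ?sqr_ge0.
Qed.

Lemma l2norm_small (u : V) (d : R) : 0 <= d ->
  (forall i, `|complex.Re (u i 0)| <= d /\ `|complex.Im (u i 0)| <= d) ->
  nr u <= d * (n.*2)%:R.
Proof.
move=> d0 h; rewrite l2_nr -[X in _ <= X]ger0_norm ?mulr_ge0 // -sqrtr_sqr.
rewrite ler_wsqrtr // exprMn; apply: (@le_trans _ _ (\sum_(i < n) (d ^+ 2 + d ^+ 2))).
  apply: ler_sum => i _; have [h1 h2] := h i.
  by apply: lerD; rewrite -real_normK ?num_real // ler_pXn2r ?nnegrE.
rewrite sumr_const card_ord -mulr2n -mulrnA mul2n -[X in X <= _]mulr_natr.
apply: ler_wpM2l; first exact: sqr_ge0.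
by rewrite -natrX ler_nat; case: (n.*2) => // k; rewrite expnS leq_pmulr.
Qed.

Lemma cauchy_image (F : set_system V) (f : V -> R) : ProperFilter F -> cauchy F ->
  (forall u v, `|f u - f v| <= nr (u - v)) -> cvg (f @ F).
Proof.
move=> FF /cauchyP Fc fL; apply: R_complete; apply: cauchy_exP => e e0.
have [|u Fu] := Fc e%:C; first by rewrite ltcR.
exists (f u); suff : F (f @^-1` ball (f u) e) by [].
apply: filterS Fu => v; rewrite -ball_normE /= ltcR => uv.
by rewrite -ball_normE /=; exact: le_lt_trans (fL _ _) uv.
Qed.

Fact l2_complete (F : set_system V) : ProperFilter F -> cauchy F -> cvg F.
Proof.
move=> FF Fc.
have cRe i : cvg ((fun u : V => complex.Re (u i 0)) @ F).
  apply: cauchy_image Fc _ => u v; rewrite -raddfB.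
  by have := l2norm_ge_Re (u - v) i; rewrite !mxE.
have cIm i : cvg ((fun u : V => complex.Im (u i 0)) @ F).
  apply: cauchy_image Fc _ => u v; rewrite -raddfB.
  by have := l2norm_ge_Im (u - v) i; rewrite !mxE.
pose l : V := \col_i (lim ((fun u : V => complex.Re (u i 0)) @ F) +i*
                     lim ((fun u : V => complex.Im (u i 0)) @ F)).
apply/cvg_ex; exists l; apply/cvgrPdist_lt => e e0.
have e0' : 0 < complex.Re e by rewrite -ltcR RRe_real ?gtr0_real.
pose d := complex.Re e / (n.*2.+1)%:R; have d0 : 0 < d by rewrite divr_gt0.
have nR : \forall u \near F, forall i, `|complex.Re ((l - u) i 0)| <= d.
  apply: filter_forall => i; move/cvgrPdist_le : (cRe i) => /(_ d d0).
  by apply: filterS => u /=; rewrite !mxE; case: (u i 0).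
have nI : \forall u \near F, forall i, `|complex.Im ((l - u) i 0)| <= d.
  apply: filter_forall => i; move/cvgrPdist_le : (cIm i) => /(_ d d0).
  by apply: filterS => u /=; rewrite !mxE; case: (u i 0).
near=> u; rewrite nrE -[e]RRe_real ?gtr0_real // ltcR.
have hR : forall i, `|complex.Re ((l - u) i 0)| <= d by near: u.
have hI : forall i, `|complex.Im ((l - u) i 0)| <= d by near: u.
have : nr (l - u) <= d * (n.*2)%:R by apply: l2norm_small => //; exact: ltW.
move=> /le_lt_trans; apply; rewrite /d mulrAC ltr_pdivrMr //.
by rewrite ltr_pM2l // ltr_nat.
Unshelve. all: by end_near. Qed.
HB.instance Definition _ := Uniform_isComplete.Build V l2_complete.

Fact l2_inner_norm (u : V) : `|u| ^+ 2 = (l2dot : {dot V for Num.conj}) u u.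
Proof. by rewrite [RHS]l2dot_norm nrE rmorphXn. Qed.
HB.instance Definition _ := isHilbert.Build R V l2_inner_norm.
End L2.

(** * Parseval frames and matrices *)

Section Frames.
Variables (R : realType) (K : hilbertType R).
Implicit Types (x y z : K) (v e : nat -> K).

Fixpoint spanset v n : set K :=
  if n is m.+1 then [set x | exists y (c : R[i]), spanset v m y /\ x = y + c *: v m]
  else [set 0].

Lemma spanset0 v n : spanset v n 0.
Proof. by elim: n => [//|n IH]; exists 0, 0; rewrite scale0r addr0. Qed.

Lemma spanset_lin v n (k : R[i]) x y :
  spanset v n x -> spanset v n y -> spanset v n (k *: x + y).
Proof.
elim: n x y => [|n IH] x y; first by move=> -> ->; rewrite scaler0 addr0.
move=> [x' [c [hx ->]]] [y' [d [hy ->]]]; exists (k *: x' + y'), (k * c + d).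
by split; [exact: IH | rewrite scalerDr scalerDl scalerA addrACA].
Qed.

Lemma spanset_sum v n m (c : nat -> R[i]) e : (forall i, (i < m)%N -> spanset v n (e i)) ->
  spanset v n (\sum_(i < m) c i *: e i).
Proof.
elim: m => [|m IH] h; first by rewrite big_ord0; exact: spanset0.
rewrite big_ord_recr /= addrC; apply: spanset_lin; first exact: h.
by apply: IH => i im; apply: h; rewrite ltnS ltnW.
Qed.

Lemma spanset_coef v n x : (exists c : nat -> R[i], x = \sum_(i < n) c i *: v i) ->
  spanset v n x.
Proof.
move=> [c ->]; elim: n => [|n IH]; first by rewrite big_ord0; exact: spanset0.
by rewrite big_ord_recr; exists (\sum_(i < n) c i *: v i), (c n).
Qed.

Definition expand n e x : K := \sum_(i < n) inner x (e i) *: e i.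

Lemma expand_lin n e (k : R[i]) x y :
  expand n e (k *: x + y) = k *: expand n e x + expand n e y.
Proof.
rewrite /expand scaler_sumr -big_split; apply: eq_bigr => i _ /=.
by rewrite ipDl ipZl scalerDl scalerA.
Qed.

Lemma ip_suml m (f : 'I_m -> K) y : inner (\sum_i f i) y = \sum_i inner (f i) y.
Proof.
by rewrite (big_morph (fun x => inner x y) (fun x z => ipDl x z y) (ip0l y)).
Qed.
Lemma ip_sumr m (f : 'I_m -> K) y : inner y (\sum_i f i) = \sum_i inner y (f i).
Proof.
by rewrite (big_morph (fun x => inner y x) (fun x z => ipDr x z y) (ip0r y)).
Qed.

Lemma expand_sym n e x y : inner (expand n e x) y = inner x (expand n e y).
Proof.
rewrite ip_suml ip_sumr; apply: eq_bigr => i _.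
by rewrite ipZl ipZr -ipC mulrC.
Qed.

(** Gram-Schmidt, keeping the null vectors: e is orthonormal up to zero entries.
    This makes the length of the frame independent of the rank of v, so frames can
    be padded to any length. *)
Lemma frame_exists v n : exists e : nat -> K,
  (forall i, (i < n)%N -> spanset v n (e i)) /\
  forall x, spanset v n x -> expand n e x = x.
Proof.
elim: n => [|n [e [e1 e2]]].
  by exists v; split => // x ->; rewrite /expand big_ord0.
pose w := v n; pose r := w - expand n e w.
have wspan : spanset v n (expand n e w) by exact: (@spanset_sum v n n (fun i => inner w (e i)) e e1).
have yr y : spanset v n y -> inner y r = 0.
  by move=> hy; rewrite ipBr -expand_sym e2 // subrr.
pose s : R[i] := ((nr r)^-1)%:C.
pose e' i := if i == n then s *: r else e i.
have eE x : expand n.+1 e' x = expand n e x + inner x (s *: r) *: (s *: r).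
  rewrite /expand big_ord_recr /= /e' eqxx; congr (_ + _).
  by apply: eq_bigr => i _; rewrite ltn_eqF.
exists e'; split => [i|x [y [c [hy ->]]]].
  rewrite /e' ltnS leq_eqVlt; case: eqP => [_ _|_ /= i_n]; last first.
    by exists (e i), 0; rewrite scale0r addr0; split => //; exact: e1.
  exists ((- s) *: expand n e w), s; split.
    by rewrite -[_ *: _]addr0; apply: spanset_lin => //; exact: spanset0.
  by rewrite scalerBr scaleNr addrC.
have ew : expand n.+1 e' w = w.
  rewrite eE ipZr scalerA -[RHS](subrK (expand n e w)) addrC; congr (_ + _).
  have -> : inner w r = (nr r ^+ 2)%:C.
    by rewrite -ip_nr -[w](subrK (expand n e w)) ipDl (yr _ wspan) addr0.
  have [r0|r0] := eqVneq r 0; first by rewrite -/r r0 scaler0.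
  rewrite -[RHS]scale1r; congr (_ *: _).
  have nr0 : nr r != 0 by apply: contra r0 => /eqP /nr_eq0 ->.
  have -> : Num.conj s = s by apply/CrealP; rewrite complex_real.
  rewrite /s -!rmorphM /=; apply: (congr1 (fun t : R => t%:C) (y := 1)).
  by field.
rewrite addrC expand_lin ew; congr (_ + _).
by rewrite eE e2 // ipZr yr // mulr0 scale0r addr0.
Qed.

End Frames.

Section Matrices.
Variables (R : realType) (A : cstarAlgType R).
Local Notation "a ** b" := (cmul a b) (at level 40, left associativity).

Lemma matrix_action n (rho : A -> 'M[R[i]]_n) : matrix_star_hom rho ->
  star_action (fun a (x : l2 R n) => rho a *m x : l2 R n).
Proof.
move=> hr; split.
- by move=> a k x y; rewrite mulmxDr scalemxAr.
- by move=> k a b x; rewrite (mhom_linear hr) mulmxDl scalemxAl.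
- by move=> a b x; rewrite (mhom_mul hr) mulmxA.
- move=> a x y; rewrite (mhom_adj hr); change (l2dot (map_mx Num.conj (rho a)^T *m x) y = l2dot x (rho a *m y)).
  rewrite /l2dot; under eq_bigr do rewrite mxE mulr_suml.
  rewrite exchange_big; apply: eq_bigr => i _ /=.
  rewrite mxE rmorph_sum mulr_sumr; apply: eq_bigr => j _ /=.
  by rewrite !mxE rmorphM; ring.
Qed.

Variables (K : hilbertType R) (pi : A -> K -> K).
Hypothesis hpi : star_action pi.

(** The matrices of an action in a frame; padding the frame with null vectors
    makes the resulting homomorphism degenerate. *)
Definition compress n (e : nat -> K) (a : A) : 'M[R[i]]_n :=
  \matrix_(i, j) inner (pi a (e j)) (e i).
Definition coords n (e : nat -> K) (x : K) : 'cV[R[i]]_n := \col_i inner x (e i).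

Lemma compress_coords n e a x : expand n e x = x ->
  compress n e a *m coords n e x = coords n e (pi a x).
Proof.
move=> ex; apply/matrixP => i j; rewrite !mxE -{2}ex /expand.
rewrite (big_morph (pi a) (saDr hpi a) (sa0r hpi a)) ip_suml.
by apply: eq_bigr => k _; rewrite !mxE saZr // ipZl mulrC.
Qed.

Lemma compress_hom n e (V : set K) : (forall i, (i < n)%N -> V (e i)) ->
  (forall x, V x -> expand n e x = x) -> (forall a x, V x -> V (pi a x)) ->
  matrix_star_hom (compress n e).
Proof.
move=> eV exV invV; split.
- by move=> k a b; apply/matrixP => i j; rewrite !mxE (sa_lin hpi) ipDl ipZl.
- move=> a b; apply/matrixP => i j.
  have := compress_coords a (exV _ (invV b _ (eV _ (ltn_ord j)))).
  move=> /matrixP /(_ i 0); rewrite !mxE (sa_mul hpi) => <-.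
  by apply: eq_bigr => k _; rewrite !mxE.
- by move=> a; apply/matrixP => i j; rewrite !mxE (sa_adj hpi) -ipC.
Qed.

Lemma coords_eq0 n e x : expand n e x = x -> coords n e x = 0 -> x = 0.
Proof.
move=> ex /matrixP c0; rewrite -ex /expand big1 // => i _.
by have := c0 i 0; rewrite !mxE => ->; rewrite scale0r.
Qed.

Lemma dim_at_most_nat d n : dim_at_most K d -> (d <= n)%N ->
  exists v : nat -> K, forall x, exists c : nat -> R[i], x = \sum_(i < n) c i *: v i.
Proof.
move=> [e he] dn; pose e' (i : nat) : K := if insub i is Some j then e j else 0.
exists e' => x; have [c ->] := he x.
pose c' (i : nat) : R[i] := if insub i is Some j then c j else 0.
exists c'; rewrite [LHS](_ : _ = \sum_(i < d) c' i *: e' i); last first.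
  by apply: eq_bigr => i _; rewrite /c' /e' valK.
rewrite (big_ord_widen n (fun i => c' i *: e' i)) // big_mkcond.
apply: eq_bigr => i _; case: ifPn => // id.
by rewrite /e' insubN // scaler0.
Qed.

Lemma dim_at_most_spanset d n : dim_at_most K d -> (d <= n)%N ->
  exists v : nat -> K, forall x, spanset v n x.
Proof.
move=> hd dn; have [v hv] := dim_at_most_nat hd dn.
by exists v => x; exact/spanset_coef/hv.
Qed.

Lemma dim_at_most_mono d n : dim_at_most K d -> (d <= n)%N -> dim_at_most K n.
Proof.
move=> hd dn; have [v hv] := dim_at_most_nat hd dn; exists (fun i => v i) => x.
by have [c cx] := hv x; exists (fun i => c i).
Qed.

End Matrices.

(** * Matrix homomorphisms *)

Section FiniteDim.
Variables (R : realType) (A : cstarAlgType R).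
Local Notation "a ** b" := (cmul a b) (at level 40, left associativity).

Lemma action_representation (K : hilbertType R) (pi : A -> K -> K) :
  star_action pi -> representation pi.
Proof.
move=> hpi; case: (hpi) => h1 h2 h3 h4; split => // a x.
apply/cvgrPdist_lt => e e0; have e0' : 0 < complex.Re e by rewrite -ltcR RRe_real ?gtr0_real.
have c0 : 0 < nr a + 1 by rewrite ltr_wpDl ?nr_ge0.
have d0 : 0 < (complex.Re e / (nr a + 1))%:C :> R[i] by rewrite ltcR divr_gt0.
have : \forall y \near x, `|x - y| < (complex.Re e / (nr a + 1))%:C.
  by move: d0; move: (_%:C) => d d0; apply: (cvgr_dist_lt (fun y : K => y) x).
apply: filterS => y; rewrite -saBr // !nrE -[e]RRe_real ?gtr0_real // !ltcR => xy.
apply: le_lt_trans (action_bounded hpi _ _) _.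
apply: (@le_lt_trans _ _ ((nr a + 1) * nr (x - y))).
  by apply: ler_wpM2r; rewrite ?nr_ge0 ?lerDl.
by rewrite mulrC -ltr_pdivlMr.
Qed.

Lemma rfd_matrix (a : A) : residually_finite_dim A -> a <> 0 ->
  exists d, forall n, (d <= n)%N ->
    exists rho : A -> 'M[R[i]]_n, matrix_star_hom rho /\ rho a <> 0.
Proof.
move=> [I [K [pi [hpi sep]]]] /sep[i [x ax]].
have [/representation_star_action hi [d hd]] := hpi i.
exists d => n dn; have [v hv] := dim_at_most_spanset hd dn.
have [e [_ e2]] := frame_exists v n.
have ex y : expand n e y = y by exact: e2.
exists (compress (pi i) n e); split.
  by apply: (@compress_hom _ _ _ _ hi n e setT).
move=> r0; apply: ax; apply: (coords_eq0 (ex _)).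
by rewrite -(compress_coords hi) // r0 mul0mx.
Qed.

(** Their Gram matrix is diagonal and invertible, and it has rank at most n. *)
Lemma orthogonal_vectors n m (v : 'I_m -> 'cV[R[i]]_n) :
  (forall i, v i != 0) -> (forall i j, i != j -> l2dot (v i : l2 R n) (v j) = 0) -> (m <= n)%N.
Proof.
move=> v0 vo; pose M : 'M[R[i]]_(m, n) := \matrix_(i, j) v i j 0.
pose G := M *m (map_mx Num.conj M)^T.
have GE i j : G i j = l2dot (v i : l2 R n) (v j).
  by rewrite !mxE; apply: eq_bigr => k _; rewrite !mxE.
have Gd : G = diag_mx (\row_i l2dot (v i : l2 R n) (v i)).
  apply/matrixP => i j; rewrite GE !mxE.
  by have [->|ij] := eqVneq i j; rewrite ?mulr1n // mulr0n vo.
have : G \in unitmx.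
  rewrite unitmxE Gd det_diag unitfE; apply/prodf_neq0 => i _.
  by rewrite mxE; apply/lt0r_neq0/l2dot_pos.
rewrite -row_free_unit => /eqP <-.
by apply: leq_trans (mxrankM_maxl _ _) _; exact: rank_leq_col.
Qed.

Lemma mx_neq0_vec m n (M : 'M[R[i]]_(m, n)) : M <> 0 -> exists u : 'cV_n, M *m u != 0.
Proof.
move=> M0; apply: contrapT => /forallNP h; apply: M0; apply/matrixP => i j.
have /negP := h (delta_mx j 0); rewrite negbK -colE => /eqP /matrixP /(_ i 0).
by rewrite !mxE.
Qed.

(** Vectors in the ranges of the rho (g i) are orthogonal. *)
Lemma orthogonal_matrices n m (rho : A -> 'M[R[i]]_n) (g : nat -> A) :
  matrix_star_hom rho ->
  (forall i, (i < m)%N -> cadj (g i) = g i /\ rho (g i) <> 0) ->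
  (forall i j, (i < m)%N -> (j < m)%N -> i != j -> g i ** g j = 0) -> (m <= n)%N.
Proof.
move=> hr g1 g2; have ha := matrix_action hr.
have nz (i : 'I_m) : exists u : 'cV[R[i]]_n, rho (g i) *m u != 0.
  by have [_ gi] := g1 i (ltn_ord i); exact: mx_neq0_vec.
have [u hu] := choice nz.
apply: (orthogonal_vectors (v := fun i => rho (g i) *m u i)) => // i j ij.
have [gs _] := g1 i (ltn_ord i).
have adj := sa_adj ha (g i) (u i) (rho (g j) *m u j : l2 R n).
rewrite gs in adj.
have rho0 : rho 0 = 0.
  by have := mhom_linear hr (-1) 0 0; rewrite scaler0 addr0 scaleN1r addNr.
have z0 : rho (g i) *m (rho (g j) *m u j) = 0.
  by rewrite mulmxA -(mhom_mul hr) g2 // rho0 mul0mx.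
exact: etrans adj (etrans (congr1 (inner (u i : l2 R n)) z0) (ip0r _)).
Qed.

Section Subspace.
Variables (n : nat) (V : set (l2 R n)).
Hypotheses (V0 : V 0) (Vlin : forall (k : R[i]) x y, V x -> V y -> V (k *: x + y)).

(** Take a vector subspace of maximal dimension inside [V]. *)
Lemma subspace_spanset : V <> setT ->
  exists d v, (d < n)%N /\ forall x, V x <-> spanset v d x.
Proof.
move=> VT.
pose Q d := `[< exists W : {vspace l2 R n}, (forall x, x \in W -> V x) /\ \dim W = d >].
have Q0 : exists d, Q d.
  exists 0; apply/asboolP; exists 0%VS; rewrite dimv0; split => // x.
  by rewrite memv0 => /eqP ->.
have dimn : \dim {:l2 R n} = n by rewrite dimvf /dim /= muln1.
have Qn d : Q d -> (d <= n)%N.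
  by move=> /asboolP[W [_ <-]]; rewrite -[X in (_ <= X)%N]dimn dimvS // subvf.
case: (ex_maxnP Q0 Qn) => d /asboolP[W [WV Wd]] dmax.
have VW x : V x -> x \in W.
  move=> Vx; have : Q (\dim (W + <[x]>)).
    apply/asboolP; exists (W + <[x]>)%VS; split => // y /memv_addP[w /WV Vw [z]].
    by move=> /vlineP[k ->] ->; rewrite addrC; exact: Vlin.
  move=> /dmax; rewrite -Wd => le.
  have /dimv_leqif_sup[le' eqd] := addvSl W <[x]>%VS.
  move: eqd; rewrite eqn_leq le' le => /esym /subvP; apply.
  by apply: (subvP (addvSr _ _)); exact: memv_line.
exists d, (fun i => (vbasis W)`_i); split => [|x].
  rewrite ltn_neqAle -{2}Wd -[X in (_ <= X)%N]dimn dimvS ?subvf // andbT -Wd.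
  apply/eqP => e; apply: VT; apply/seteqP; split => // x _; apply: WV.
  have /dimv_leqif_eq[_] := subvf W; rewrite dimn e eqxx => /esym /eqP ->.
  exact: memvf.
have vW i : (i < d)%N -> (vbasis W)`_i \in W.
  by move=> id; apply: vbasis_mem; rewrite mem_nth // size_tuple Wd.
split => [/VW xW|].
  apply: spanset_coef; subst d.
  exists (fun i => if insub i is Some j then coord (vbasis W) j x else 0).
  rewrite {1}(coord_vbasis xW); apply: eq_bigr => i _.
  by rewrite valK.
elim: (d) vW x => [_ x -> //|m IH vW x [y [c [hy ->]]]].
rewrite addrC; apply: Vlin; first by apply/WV/vW.
by apply: IH hy => i im; apply: vW; rewrite ltnS ltnW.
Qed.
End Subspace.

(** Take a nonzero homomorphism into matrices of the smallest possible size.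
    Compressing it to a proper invariant subspace gives smaller matrices, hence 0.
    This applies to V and to its orthogonal complement, which together span. *)
Lemma irrep_exists n0 : (exists rho : A -> 'M[R[i]]_n0, matrix_star_hom rho /\ exists a, rho a <> 0) ->
  exists d, (0 < d)%N /\ forall n, (d <= n)%N -> has_irrep_dim_at_most A n.
Proof.
move=> h0.
pose Q d := `[< exists rho : A -> 'M[R[i]]_d, matrix_star_hom rho /\ exists a, rho a <> 0 >].
have Qex : exists d, Q d by exists n0; apply/asboolP.
case: (ex_minnP Qex) => d /asboolP[rho [hr [a0 ha0]]] dmin.
pose s := fun a (x : l2 R d) => rho a *m x : l2 R d.
have hs : star_action s := matrix_action hr.
(* A proper invariant subspace is killed, by minimality of d. *)
have killed (V : set (l2 R d)) : V 0 -> (forall (k : R[i]) x y, V x -> V y -> V (k *: x + y)) ->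
    V <> setT -> (forall a x, V x -> V (s a x)) ->
    exists m e, [/\ forall i, (i < m)%N -> V (e i), forall x, V x -> expand m e x = x &
      forall a x, V x -> s a x = 0].
  move=> V0 Vlin VT inv; have [m [v [md hv]]] := subspace_spanset V0 Vlin VT.
  have [e [e1 e2]] := frame_exists v m.
  have eV i : (i < m)%N -> V (e i) by move=> /e1 /hv.
  have ex x : V x -> expand m e x = x by move=> /hv /e2.
  exists m, e; split => // a x Vx; apply: (coords_eq0 (ex _ (inv a _ Vx))).
  rewrite -(compress_coords hs) ?ex //.
  suff -> : compress s m e a = 0 by rewrite mul0mx.
  apply: contrapT => ca; have : Q m.
    apply/asboolP; exists (compress s m e); split; last by exists a.
    exact: (compress_hom hs eV ex inv).
  by move=> /dmin; rewrite leqNgt md.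
have nz : exists a x, s a x <> 0.
  by have [x /eqP hx] := mx_neq0_vec ha0; exists a0, x.
have irr : irreducible s.
  split=> // V [V0 Vlin _] inv; have [VT|VT] := pselect (V = setT); first by right.
  left; have [m [e [eV ex sV]]] := killed V V0 Vlin VT inv.
  pose W := [set y | forall x, V x -> inner x y = 0].
  have [W1|WT] := pselect (W = setT).
    apply/seteqP; split => x /=; last by move=> ->.
    by move=> Vx; have Wx : W x by [rewrite W1]; apply: ip_eq0; exact: Wx.
  have [|||_ [_ [_ _ sW]]] := killed W _ _ WT.
  - by move=> x _; rewrite ip0r.
  - by move=> k x y hx hy z Vz; rewrite ipDr ipZr hx // hy // mulr0 addr0.
  - by move=> a y hy x Vx; rewrite -(sa_adj hs); apply/hy/inv.
  exfalso; have [a [z]] := nz; apply.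
  have Vz : V (expand m e z).
    rewrite /expand; apply: (big_ind V) => // [x y Vx Vy|i _].
      by rewrite -[x]scale1r; exact: Vlin.
    by rewrite -[_ *: _]addr0; apply: Vlin => //; exact: eV.
  have ze : z = (z - expand m e z) + expand m e z by rewrite subrK.
  rewrite ze saDr // [s a (expand _ _ _)]sV // addr0; apply: sW => x Vx.
  by rewrite ipBr -expand_sym ex // subrr.
exists d; split=> [|n dn].
  rewrite lt0n; apply/eqP => d0; apply: ha0; apply/matrixP => i; exfalso.
  by have := ltn_ord i; rewrite [X in (_ < X)%N]d0.
exists (l2 R d), s; split => //; first exact: action_representation.
apply: dim_at_most_mono dn; exists (fun i => delta_mx i 0) => x.
exists (fun i => x i 0); apply/matrixP => i j; rewrite (ord1 j) summxE (bigD1 i) //=.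
rewrite big1 => [|k ki]; rewrite !mxE ?eqxx ?mulr1 ?addr0 //.
by rewrite eq_sym (negbTE ki) mulr0.
Qed.

End FiniteDim.

(** * The nested sequence *)

Section Tower.
Variables (R : realType) (A : cstarAlgType R) (H : hilbertType R).
Variable s : A -> H -> H.
Hypotheses (hs : star_action s) (irr : irreducible s) (infH : ~ finite_dim H).
Hypothesis hRFD : residually_finite_dim A.
Local Notation U := (unitz A).
Local Notation "a ** b" := (cmul a b) (at level 40, left associativity).
Local Notation live := (live s).

(** A product through n + 1 orthogonal elements, one of which is 0 in any n x n
    matrices. *)
Lemma live_killed n : exists w, live w /\
  forall rho : A -> 'M[R[i]]_n, matrix_star_hom rho -> rho w = 0.
Proof.
have [g [g1 g2]] := orthogonal_family_exists hs irr infH n.+1.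
have partial m : (m <= n.+1)%N -> exists w, live w /\
    forall rho : A -> 'M[R[i]]_n, matrix_star_hom rho ->
    (exists2 i, (i < m)%N & rho (g i) = 0) -> rho w = 0.
  have [_ g0] := g1 0 isT; elim: m => [_|m IH mn].
    by exists (g 0); split=> // rho _ [j]; rewrite ltn0.
  have [w [lw hw]] := IH (ltnW mn); have [_ lg] := g1 m mn.
  have [y ly] := live_prime hs irr lw lg; exists (w ** y ** g m); split=> // rho hr [j].
  rewrite !(mhom_mul hr) ltnS leq_eqVlt => /predU1P[->|jm] rj.
    by rewrite rj mulmx0.
  by rewrite hw ?mul0mx //; exists j.
have [w [lw hw]] := partial n.+1 (leqnn _).
exists w; split=> // rho hr; apply: hw => //; apply: contrapT => h.
have gne i : (i < n.+1)%N -> cadj (g i) = g i /\ rho (g i) <> 0.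
  move=> i_n; split; first by have [] := g1 i i_n.
  by move=> r0; apply: h; exists i.
by have := orthogonal_matrices hr gne g2; rewrite ltnn.
Qed.

Record tower_step (n : nat) (g : A) (n' : nat) (b' g' : A) : Prop := TowerStep {
  ts_lt : (n < n')%N;
  ts_nr : nr b' <= 1;
  ts_bg : b' ** g' = g';
  ts_live : live g';
  ts_below : below b' g;
  ts_kill : forall rho : A -> 'M[R[i]]_n, matrix_star_hom rho -> rho b' = 0;
  ts_see : exists rho : A -> 'M[R[i]]_n', matrix_star_hom rho /\ rho g' <> 0
}.

(** Apply [urysohn_exists] to h = q q^* with q = g y w, w from [live_killed]: the
    left factor g keeps the support, and the right factor w kills small matrices. *)
Lemma tower_step_exists n g : live g -> exists n' b' g', tower_step n g n' b' g'.
Proof.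
move=> lg; have [w [lw hw]] := live_killed n.
have [y ly] := live_prime hs irr lg lw; set q := _ ** w in ly.
pose h := q ** cadj q; have hh : cadj h = h by rewrite cadjM cadjK.
have [b' [g' [[_ _ b1 bg kill act0] lg']]] := urysohn_exists hs hh (live_star hs ly).
have g'0 : g' <> 0 by move=> e; have [x] := lg'; rewrite e sa0l.
have [d hd] := rfd_matrix hRFD g'0.
exists (maxn d n.+1), b', g'; split => //.
- exact: leq_maxr.
- by move=> T Tg; apply: kill; rewrite /h /q !embM !mulrA Tg !mul0r.
- move=> rho hr; apply: contrapT => /mx_neq0_vec[u /eqP]; apply.
  apply: (act0 _ _ (matrix_action hr)) => x.
  by rewrite /h /q !(mhom_mul hr) (hw _ hr) mulmx0 !mul0mx.
- exact/hd/leq_maxl.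
Qed.

Lemma tower_exists : exists (M : nat -> nat) (b : nat -> A),
  [/\ forall k, (0 < M k)%N, forall k, (M k < M k.+1)%N,
      forall k, has_irrep_dim_at_most A (M k),
      forall k, nr (b k) <= 1 &
      (forall k j (rho : A -> 'M[R[i]]_(M k)), (k < j)%N -> matrix_star_hom rho ->
        rho (b j) = 0) /\
      forall k, exists (rho : A -> 'M[R[i]]_(M k)) (v : 'cV[R[i]]_(M k)),
        [/\ matrix_star_hom rho, v != 0 & forall j, (j <= k)%N -> rho (b j) *m v = v]].
Proof.
have [[a0 la0] _] := irr.
have a00 : a0 <> 0 by move=> e; have [x] := la0; rewrite e sa0l.
have [d hd] := rfd_matrix hRFD a00.
have [n0 [n00 hn0]] : exists d, (0 < d)%N /\ forall n, (d <= n)%N -> has_irrep_dim_at_most A n.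
  by have [rho [hr ha]] := hd d (leqnn d); apply: irrep_exists; exists rho; split => //; exists a0.
have [x|F hF] := @choice (nat * A)%type (nat * A * A)%type
    (fun x t => live x.2 -> tower_step x.1 x.2 t.1.1 t.1.2 t.2).
  have [l|nl] := pselect (live x.2); last by exists (0%N, 0, 0).
  by have [n' [b' [g' h]]] := tower_step_exists x.1 l; exists (n', b', g').
pose st := fix st k := if k is j.+1 then F ((st j).1.1, (st j).2) else F (n0, a0).
pose M k := (st k).1.1; pose b k := (st k).1.2; pose g k := (st k).2.
have s0 : tower_step n0 a0 (M 0) (b 0) (g 0) by exact: hF (n0, a0) la0.
have stepS k : live (g k) -> tower_step (M k) (g k) (M k.+1) (b k.+1) (g k.+1).
  by move=> lg; exact: hF (M k, g k) lg.
have lg k : live (g k).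
  elim: k => [|k IH]; first by case: s0.
  by case: (stepS k IH).
have {}stepS k := stepS k (lg k).
have Mlt k : (M k < M k.+1)%N by case: (stepS k).
have M0 k : (n0 < M k)%N.
  elim: k => [|k IH]; first by case: s0.
  exact: ltn_trans IH (Mlt k).
have bg k : b k ** g k = g k.
  by case: k => [|k]; [case: s0 | case: (stepS k)].
have gg k : below (g k.+1) (g k).
  by move=> T Tg; rewrite -bg embM mulrA (ts_below (stepS k)) // mul0r.
have gbelow k j : (k <= j)%N -> below (g j) (g k).
  move=> /subnKC <-; elim: (j - k)%N => [|m IH]; first by rewrite addn0.
  by rewrite addnS => T /IH /gg.
have one_sub x y : (1 - emb x) * emb y = 0 -> x ** y = y.
  rewrite mulrBl mul1r -embM => /subr0_eq e; exact/esym/emb_inj.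
have fixg k j : (k <= j)%N -> b k ** g j = g j.
  move=> kj; apply/one_sub/(gbelow _ _ kj).
  by rewrite mulrBl mul1r -embM bg subrr.
have fixb k j : (k < j)%N -> b k ** b j = b j.
  case: j => // j; rewrite ltnS => kj; apply: one_sub.
  apply: (ts_below (stepS j)); rewrite mulrBl mul1r -embM fixg // subrr //.
exists M, b; split => //.
- by move=> k; exact: ltn_trans n00 (M0 k).
- by move=> k; exact/hn0/ltnW.
- by case=> [|k]; [case: s0 | case: (stepS k)].
split => [k j rho kj hr|k].
  have rk : rho (b k.+1) = 0 by exact: (ts_kill (stepS k)).
  move: kj; rewrite leq_eqVlt => /predU1P[<- //|kj].
  by rewrite -(fixb _ _ kj) (mhom_mul hr) rk mul0mx.
have [rho [hr rg]] : exists rho : A -> 'M[R[i]]_(M k), matrix_star_hom rho /\ rho (g k) <> 0.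
  by case: k => [|k]; [case: s0 | case: (stepS k)].
have [u hu] := mx_neq0_vec rg; exists rho, (rho (g k) *m u); split => // j jk.
by rewrite mulmxA -(mhom_mul hr) fixg.
Qed.

End Tower.

(** * Prescribing the norms *)

Section OperatorNorm.
Variables (R : realType) (n : nat).
Implicit Types (M : 'M[R[i]]_n) (v : 'cV[R[i]]_n).

Lemma opnorm_le M r : 0 <= r -> (forall v, l2norm (M *m v) <= r * l2norm v) ->
  opnorm M <= r.
Proof.
move=> r0 h; apply: ge_sup.
  exists (l2norm (M *m 0)), 0 => //=.
  by rewrite -(l2_nr (0 : l2 R n)) nr0 ler01.
move=> _ [v /= v1 <-]; apply: le_trans (h v) _.
by rewrite ler_piMr.
Qed.

Lemma opnorm_ge M r v : (forall v, l2norm (M *m v) <= r * l2norm v) -> 0 <= r ->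
  v != 0 -> l2norm (M *m v) = r * l2norm v -> r <= opnorm M.
Proof.
move=> h r0 v0 e.
have nv : 0 < nr (v : l2 R n) by apply: nr_gt0; exact/eqP.
pose u : l2 R n := ((nr (v : l2 R n))^-1)%:C *: (v : l2 R n).
have u1 : l2norm u = 1.
  by rewrite -(l2_nr u) nrZr ger0_norm ?invr_ge0 ?nr_ge0 // mulVf // gt_eqF.
apply: ub_le_sup.
  by exists r => _ [w /= w1 <-]; apply: le_trans (h w) _; rewrite ler_piMr.
exists u; first by rewrite /= u1.
have -> : M *m u = ((nr (v : l2 R n))^-1)%:C *: (M *m v) by rewrite /u -scalemxAr.
have := nrZr (nr (v : l2 R n))^-1 (M *m v : l2 R n); rewrite !l2_nr e => ->.
by rewrite ger0_norm ?invr_ge0 ?ltW // mulrCA mulVf ?mulr1 // gt_eqF.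
Qed.
End OperatorNorm.

Section Realization.
Variables (R : realType) (A : cstarAlgType R).

(** The sum of the b_k weighted by the increments of L. Its tail is invisible in the
    sizes below, and the weights of the terms visible in size M_k add up to L_k. *)
Lemma realize (M : nat -> nat) (b : nat -> A) (L : nat -> R) (lambda : R) :
  (forall k, nr (b k) <= 1) ->
  (forall k j (rho : A -> 'M[R[i]]_(M k)), (k < j)%N -> matrix_star_hom rho ->
    rho (b j) = 0) ->
  (forall k, exists (rho : A -> 'M[R[i]]_(M k)) (v : 'cV[R[i]]_(M k)),
    [/\ matrix_star_hom rho, v != 0 & forall j, (j <= k)%N -> rho (b j) *m v = v]) ->
  0 <= L 0 -> (forall k, L k <= L k.+1) -> (forall k, L k <= lambda) ->
  (forall e, 0 < e -> exists N, lambda - L N < e) ->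
  exists a : A, (forall k, norm_Mn (M k) a = L k) /\ nr a = lambda.
Proof.
move=> b1 kill see L0 LS Ll Lt.
pose S := fix S k : A := if k is j.+1 then S j + (L j.+1 - L j)%:C *: b j.+1
                         else (L 0)%:C *: b 0.
have Lge0 k : 0 <= L k by elim: k => // k IH; exact: le_trans IH (LS k).
have Lmono k j : (k <= j)%N -> L k <= L j.
  move=> /subnKC <-; elim: (j - k)%N => [|m IH]; first by rewrite addn0.
  by rewrite addnS; exact: le_trans IH (LS _).
have bnr k (r : R) : 0 <= r -> nr (r%:C *: b k) <= r.
  by move=> r0; rewrite nrZr ger0_norm // ler_piMr.
have Sd j : nr (S j.+1 - S j) <= L j.+1 - L j.
  by rewrite /= addrAC subrr add0r bnr // subr_ge0.
have Snr k : nr (S k) <= L k.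
  elim: k => [|k IH]; first exact: bnr.
  rewrite -(subrK (S k) (S k.+1)) -(subrK (L k) (L k.+1)).
  exact: le_trans (nrD _ _) (lerD (Sd k) IH).
have [a ha] := nr_majorant_lim Sd Ll Lt.
have Sfix k (rho : A -> 'M[R[i]]_(M k)) j : matrix_star_hom rho ->
    rho (S (k + j)%N) = rho (S k).
  move=> hr; have hl := mhom_linear hr; elim: j => [|j IH]; first by rewrite addn0.
  by rewrite addnS /= addrC hl kill // ?ltnS ?leq_addr // scaler0 add0r.
have rhoa k (rho : A -> 'M[R[i]]_(M k)) : matrix_star_hom rho ->
    forall v : 'cV[R[i]]_(M k), rho a *m v = rho (S k) *m v.
  move=> hr v; have hact := matrix_action hr.
  suff d0 : nr ((rho a - rho (S k)) *m v : l2 R (M k)) <= 0.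
    apply: subr0_eq; rewrite -mulmxBl.
    by apply: (@nr_eq0 _ (l2 R (M k))); apply/eqP; rewrite eq_le nr_ge0 andbT.
  apply: (@le_small R _ 0 (nr (v : l2 R (M k))) (fun j => lambda - L (k + j)%N)) => [|e e0|j].
  - exact: nr_ge0.
  - have [N hN] := Lt e e0; exists N; apply: le_lt_trans hN; rewrite lerD2l lerN2.
    exact: Lmono (leq_addl k N).
  rewrite add0r -(Sfix k rho j hr) mulmxBl nrBC.
  have h := action_bounded hact (S (k + j)%N - a) (v : l2 R (M k)).
  rewrite (saBl hact (S (k + j)%N) a (v : l2 R (M k))) in h.
  apply: le_trans h _; rewrite mulrC.
  by apply: ler_wpM2l (ha _); exact: nr_ge0.
have upper k (rho : A -> 'M[R[i]]_(M k)) : matrix_star_hom rho ->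
    forall v, l2norm (rho a *m v) <= L k * l2norm v.
  move=> hr v; rewrite rhoa //.
  have := action_bounded (matrix_action hr) (S k) (v : l2 R (M k)).
  rewrite !l2_nr => h; apply: le_trans h _.
  by apply: ler_wpM2r (Snr k); exact: sqrtr_ge0.
have lower k : exists (rho : A -> 'M[R[i]]_(M k)) (v : 'cV[R[i]]_(M k)),
    [/\ matrix_star_hom rho, v != 0 & rho a *m v = (L k)%:C *: v].
  have [rho [v [hr v0 hv]]] := see k; exists rho, v; split => //; rewrite rhoa //.
  have hact := matrix_action hr.
  suff hS j : (j <= k)%N -> rho (S j) *m v = (L j)%:C *: v by exact: hS.
  elim: j => [_|j IH jk].
    by have := saZl hact (L 0)%:C (b 0) v; rewrite /= hv.
  have := saDl hact (S j) ((L j.+1 - L j)%:C *: b j.+1) v.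
  rewrite (saZl hact) /= hv // IH ?(ltnW jk) // => ->.
  by rewrite -scalerDl -rmorphD /= addrC subrK.
exists a; split => [k|].
  have ub : ubound [set opnorm (pi a) | pi in
      [set pi : A -> 'M[R[i]]_(M k) | matrix_star_hom pi]] (L k).
    by move=> _ [rho hr <-]; apply: opnorm_le => //; exact: upper.
  have [rho [v [hr v0 hv]]] := lower k.
  apply/eqP; rewrite eq_le; apply/andP; split.
    by apply: ge_sup => //; exists (opnorm (rho a)), rho.
  apply: (@le_trans _ _ (opnorm (rho a))); last first.
    by apply: ub_le_sup; [exists (L k) | exists rho].
  apply: (@opnorm_ge _ _ _ _ v) => //; first exact: upper.
  rewrite hv -(l2_nr (_ *: (v : l2 R _))) nrZr ger0_norm //.
apply/eqP; rewrite eq_le; apply/andP; split.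
  apply: le_trans (_ : nr (S 0%N) + nr (S 0%N - a) <= _).
    by rewrite -{1}(subKr (S 0%N) a) nrB.
  by apply: le_trans (lerD (Snr 0%N) (ha 0%N)) _; rewrite addrC subrK.
apply: (@le_small R _ _ 1 (fun j => lambda - L j)) => // j; rewrite mul1r.
have [rho [v [hr v0 hv]]] := lower j.
have nv : 0 < nr (v : l2 R (M j)) by apply: nr_gt0; exact/eqP.
have := action_bounded (matrix_action hr) a (v : l2 R (M j)).
rewrite hv nrZr ger0_norm // ler_pM2r // => h.
by rewrite -lerBlDr opprB addrC subrK.
Qed.

End Realization.

Theorem theorem5p7 (R : realType) (A : cstarAlgType R)
    (hRFD : residually_finite_dim A) (hinf : has_infinite_dim_irrep A) :
  exists M : nat -> nat,
    [/\ forall k, (0 < M k)%N,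
        forall k, (M k < M k.+1)%N,
        forall k, has_irrep_dim_at_most A (M k) &
        forall (N : nat) (lam : 'I_N.+1 -> R) (lambda : R),
          (forall i, 0 <= lam i) ->
          (forall i j : 'I_N.+1, (i <= j)%N -> lam i <= lam j) ->
          lam ord_max <= lambda ->
          exists a : A,
            [/\ forall i : 'I_N.+1, norm_Mn (M i) a = lam i,
                `|a| = lambda%:C &
                lam ord_max < lambda ->
                forall k, `|a| <> (norm_Mn (M k) a)%:C]].
Proof.
have [H [s [/representation_star_action hs irr infH]]] := hinf.
have [M [b [M0 MS Mirr b1 [kill see]]]] := tower_exists hs irr infH hRFD.
exists M; split => // N lam lambda lam0 lamS lamN.
(* For k <= N the exponent k - N is 0, so that L k = lam k. *)
pose l k := lam (inord (minn k N)).
pose L k := lambda - (lambda - l k) / 2 ^+ (k - N).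
have lS k : l k <= l k.+1.
  apply: lamS; rewrite !inordK ?ltnS ?geq_minr //.
  by rewrite leq_min geq_minr andbT; apply: leq_trans (geq_minl _ _) (leqnSn _).
have lN k : l k <= lam ord_max by apply: lamS; exact: leq_ord.
have ll k : l k <= lambda by exact: le_trans (lN k) lamN.
have p2 k : 0 < 2 ^- k :> R by rewrite invr_gt0 exprn_gt0.
have Ll k : L k <= lambda.
  by rewrite lerBlDr lerDl mulr_ge0 ?subr_ge0 // ltW.
have LS k : L k <= L k.+1.
  rewrite lerD2l lerN2; apply: ler_pM.
  - by rewrite subr_ge0.
  - exact: ltW.
  - by rewrite lerD2l lerN2.
  - by rewrite lef_pV2 ?posrE ?exprn_gt0 // ler_weXn2l ?ler1n // leq_sub2r.
have L0 : 0 <= L 0.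
  by rewrite /L sub0n expr0 divr1 subKr; exact: lam0.
have Lt e : 0 < e -> exists K, lambda - L K < e.
  move=> e0; (* The 1 covers the case where lambda is the last prescribed value. *)
  have d0 : 0 < lambda - lam ord_max + 1 by rewrite ltr_wpDl ?subr_ge0.
  have h1 : 2^-1 < 1 :> R by rewrite invf_lt1 // ltr1n.
  have h0 : 0 <= 2^-1 :> R by rewrite invr_ge0.
  have [K hK] := expr_small h0 h1 (divr_gt0 e0 d0).
  exists (N + K)%N; rewrite /L opprB addrC subrK addKn /l.
  rewrite (_ : inord _ = ord_max); last first.
    by apply: val_inj; rewrite /= inordK ?(minn_idPr (leq_addr _ _)).
  rewrite -exprVn; apply: le_lt_trans (_ : _ <= (lambda - lam ord_max + 1) * 2^-1 ^+ K) _.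
    by rewrite ler_wpM2r ?exprn_ge0 // lerDl.
  by rewrite mulrC -ltr_pdivlMr.
have [a [aL al]] := realize b1 kill see L0 LS Ll Lt.
exists a; split.
- move=> i; rewrite aL /L; have iN : (i <= N)%N := leq_ord i.
  rewrite (eqP iN) expr0 divr1 subKr /l (minn_idPl iN); congr lam.
  by apply: val_inj; rewrite /= inordK.
- by rewrite nrE al.
- move=> lt k; rewrite nrE al aL => /complexI /eqP.
  rewrite eq_sym subr_eq addrC -subr_eq subrr eq_sym mulf_eq0 invr_eq0 expf_eq0.
  rewrite pnatr_eq0 andbF orbF subr_eq0 => /eqP e.
  by have := lN k; rewrite -e leNgt lt.
Qed.
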